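(* Let $\mathfrak{C}$ be the Cartan group and let $\Omega \subset \mathfrak{C}$ be open. If $f : \Omega \to \mathfrak{C}$ is a $C^1$-smooth contact mapping, then $f$ is $C^\infty$-smooth.
   Context: The Cartan group $\mathfrak{C}$ is the set $\mathbb{R}^5$ with coordinates $(x_1,x_2,y,z_1,z_2)$ and group product $(x_1,x_2,y,z_1,z_2)(x_1',x_2',y',z_1',z_2') = (P_1,P_2,P_3,P_4,P_5)$, where $P_1 = x_1+x_1'$, $P_2 = x_2+x_2'$, $P_3 = y+y'+\tfrac12(x_1x_2'-x_2x_1')$, $P_4 = z_1+z_1'+\tfrac12(x_1y'-yx_1')+\tfrac1{12}(x_1-x_1')(x_1x_2'-x_2x_1')$, $P_5 = z_2+z_2'+\tfrac12(x_2y'-yx_2')+\tfrac1{12}(x_2-x_2')(x_1x_2'-x_2x_1')$. It is a connected, simply connected Lie group. Consider the left-invariant vector fields $X_1 = \partial_{x_1}-\tfrac12x_2\partial_y-\tfrac12(y+\tfrac16x_1x_2)\partial_{z_1}-\tfrac1{12}x_2^2\partial_{z_2}$, $X_2 = \partial_{x_2}+\tfrac12x_1\partial_y+\tfrac1{12}x_1^2\partial_{z_1}-\tfrac12(y-\tfrac16x_1x_2)\partial_{z_2}$. The horizontal distribution is $\mathrm{H}_p\mathfrak{C} = \mathrm{span}(X_1|_p,X_2|_p)$ for $p\in\mathfrak{C}$, and for an open set $U\subset\mathfrak{C}$, $\mathrm{H}U$ is its restriction to $U$. For $k\ge 1$, a map $f:\Omega\to\mathfrak{C}$ is a $C^k$-diffeomorphism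 if $f:\Omega\to f(\Omega)$ is a homeomorphism and both $f$ and $f^{-1}$ are $C^k$-smooth. A $C^k$-smooth contact mapping is a $C^k$-diffeomorphism $f:\Omega\to\mathfrak{C}$ such that $Df(\mathrm{H}\Omega)=\mathrm{H}f(\Omega)$, i.e. $Df_p(\mathrm{H}_p\mathfrak{C})=\mathrm{H}_{f(p)}\mathfrak{C}$ for all $p\in\Omega$. Smoothness is in the usual sense for maps between open subsets of $\mathbb{R}^5$. *)

(* Defs.v *)
From HB Require Import structures.
From mathcomp Require Import all_boot all_order all_algebra.
From mathcomp Require Import all_classical all_reals all_analysis.
From mathcomp Require Import ring.
Import Order.TTheory GRing.Theory Num.Theory.
Import numFieldNormedType.Exports.

Set Implicit Arguments.
Unset Strict Implicit.
Unset Printing Implicit Defensive.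

Local Open Scope classical_set_scope.
Local Open Scope ring_scope.

Section Smoothness.
Context {R : realType} {m n : nat}.
Implicit Types (U : set 'rV[R]_m.+1) (f : 'rV[R]_m.+1 -> 'rV[R]_n.+1).

(* Functions are total, and [U] is meant to be open, so that continuity and
   differentiability at a point of [U] depend only on the restriction of [f]
   to [U].  [f] is C^(k+1) when it is Fréchet differentiable on [U] and all its
   partial derivatives are C^k. *)
Fixpoint Ck (k : nat) U f : Prop :=
  if k is k'.+1 then
    (forall p, U p -> differentiable f p) /\
    (forall i : 'I_m.+1, Ck k' U (fun p => 'D_(delta_mx 0 i) f p))
  else forall p, U p -> {for p, continuous f}.

Definition Cinfty U f : Prop := forall k, Ck k U f.

End Smoothness.

Section Cartan.
Context {R : realType}.
Local Notation V := 'rV[R]_5.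
Implicit Types (p q : V) (U : set V) (f g : V -> V).

Definition vec5 (a b c d e : R) : V := \row_(i < 5) [:: a; b; c; d; e]`_i.

Definition cx1 p : R := p 0 0.
Definition cx2 p : R := p 0 1.
Definition cy p : R := p 0 2.
Definition cz1 p : R := p 0 3.
Definition cz2 p : R := p 0 4.

Definition cartan_mul p q : V :=
  let w := cx1 p * cx2 q - cx2 p * cx1 q in
  vec5 (cx1 p + cx1 q)
       (cx2 p + cx2 q)
       (cy p + cy q + 2^-1 * w)
       (cz1 p + cz1 q + 2^-1 * (cx1 p * cy q - cy p * cx1 q)
          + 12^-1 * (cx1 p - cx1 q) * w)
       (cz2 p + cz2 q + 2^-1 * (cx2 p * cy q - cy p * cx2 q)
          + 12^-1 * (cx2 p - cx2 q) * w).

Definition X1 p : V :=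
  vec5 1 0 (- (2^-1 * cx2 p))
       (- (2^-1 * (cy p + 6^-1 * cx1 p * cx2 p)))
       (- (12^-1 * cx2 p ^+ 2)).

Definition X2 p : V :=
  vec5 0 1 (2^-1 * cx1 p)
       (12^-1 * cx1 p ^+ 2)
       (- (2^-1 * (cy p - 6^-1 * cx1 p * cx2 p))).

Definition horizontal p : {vspace V} := <<[:: X1 p; X2 p]>>%VS.

(* The existential [g] is the inverse of [f : U -> f @` U]; its values off the
   image are irrelevant.  Openness of the image is what gives a meaning to the
   smoothness of [g]; by invariance of domain it follows from the other
   clauses. *)
Definition diffeomorphism (k : nat) U f : Prop :=
  exists g,
    [/\ forall p, U p -> g (f p) = p,
        {within U, continuous f} /\ {within f @` U, continuous g},
        open (f @` U),
        Ck k U f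
      & Ck k (f @` U) g].

Definition contact_mapping (k : nat) U f : Prop :=
  diffeomorphism k U f /\
  forall p, U p -> 'd f p @` [set` horizontal p] = [set` horizontal (f p)].

Lemma vec5E a b c d e :
  (cx1 (vec5 a b c d e) = a) * (cx2 (vec5 a b c d e) = b) *
  (cy (vec5 a b c d e) = c) * (cz1 (vec5 a b c d e) = d) *
  (cz2 (vec5 a b c d e) = e).
Proof. by rewrite /cx1 /cx2 /cy /cz1 /cz2 !mxE. Qed.

Lemma vec5_eta p : p = vec5 (cx1 p) (cx2 p) (cy p) (cz1 p) (cz2 p).
Proof.
by apply/rowP => -[[|[|[|[|[|//]]]]] ?];
  rewrite !mxE /=; congr (p _ _); apply/val_inj.
Qed.

Lemma cartan_mulA : associative cartan_mul.
Proof.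
by move=> p q r; rewrite /cartan_mul /= !vec5E; congr vec5; field.
Qed.

(* [X1] and [X2] are the derivatives at [t = 0] of the left translates of the
   first two coordinate lines through the identity. *)
Lemma cartan_mul_line1 p t :
  cartan_mul p (vec5 t 0 0 0 0) =
  p + t *: X1 p + t ^+ 2 *: vec5 0 0 0 (12^-1 * cx2 p) 0.
Proof.
rewrite [X in X + _ + _]vec5_eta /cartan_mul /X1 /= !vec5E.
apply/rowP => -[[|[|[|[|[|//]]]]] ?]; rewrite !mxE /=; by field.
Qed.

Lemma cartan_mul_line2 p t :
  cartan_mul p (vec5 0 t 0 0 0) =
  p + t *: X2 p + t ^+ 2 *: vec5 0 0 0 0 (- (12^-1 * cx1 p)).
Proof.
rewrite [X in X + _ + _]vec5_eta /cartan_mul /X2 /= !vec5E.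
apply/rowP => -[[|[|[|[|[|//]]]]] ?]; rewrite !mxE /=; by field.
Qed.

End Cartan.

(* Main.v *)
Require Import Defs.
From mathcomp Require Import all_boot all_order all_algebra.
From mathcomp Require Import all_classical all_reals all_analysis.
From mathcomp Require Import ring lra.
Import Order.TTheory GRing.Theory Num.Theory.
Import numFieldNormedType.Exports.
Set Implicit Arguments.
Unset Strict Implicit.
Unset Printing Implicit Defensive.
Local Open Scope classical_set_scope.
Local Open Scope ring_scope.

(** The curves [t |-> p ** (t *: hv a b)], called horizontal lines below, are
the abnormal curves of the horizontal distribution of the Cartan group.  A
contact map sends each of them into a line of the same kind, with a projective
change of parameter, and this rigidity makes the map rational near every point.

Let [m] be the differential of the contact map f in left-invariant frames.  The
identity d(f^*theta) = f^*(d theta), for theta one of the three left-invariant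
forms that vanish on the horizontal planes, would normally need two derivatives
of f.  In horizontal directions one suffices: the images of two neighbouring
horizontal lines are compared by left division in the group, both images are
horizontal curves, and so the t-derivative of the quotient is a polynomial in
first derivatives ([derive_lim], [variation_y], [variation_z]).  The resulting
structure equations ([structure_y], [structure_z]) express [m] modulo its
horizontal components through the matrix A = (X_i f_j), its determinant J and
two functions zeta_i, and they give J, zeta_i and A derivatives along horizontal
directions v: v(J) = - zeta_v / 3, and v(A v) = 2 (v(J) / J) A v.

By the last equation the image of a horizontal line has a constant direction
([line_collinear]).  Differentiating this collinearity across a family of
horizontal lines ([bending]) and expanding to second order at a point of one
line gives v(v(J)) = 2 v(J)^2 / J ([schwarzian]), which says that 1/J is affine
on every horizontal line.  The image of the line is then run through with the
parameter t J(t) / J(0), and so the products of 1/J with x1, x2, y,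
6 z1 + x1 y and 6 z2 + x2 y evaluated at f are affine on horizontal lines too
([affine_Jinv], [affine_image]).

A function F that is affine on horizontal lines, with slope linear in the
direction, is a polynomial near every point ([affine_local]).  Subtract from F
its value and slope at a point o.  The points reached from o by two horizontal
segments lie on a quartic hypersurface P = 0, where F is governed by one function
c on the plane of first vertices.  Given a line of that plane, a suitable point
off the hypersurface is joined by a segment to one endpoint for each first vertex
on the line; so c is affine on lines, hence affine ([biaffine]).  After one more
polynomial is subtracted, F vanishes on the hypersurface.  The directions of the
segments from a point q off it that end on it form an affine line, which forces
the slopes of F and P at q to be in the ratio F(q) : P(q), so that F/P is locally
constant ([proportional]).

Hence 1/J and its products with the components of f are locally polynomials, f
is locally rational, and rational functions are smooth where defined
([locally_rational_Ck]). *)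

Local Notation "p ** q" := (cartan_mul p q) (at level 40, left associativity).

(** * Calculus on the line *)

Section RealCalculus.
Context {R : realType}.
Implicit Types (g : R -> R).

Lemma deriveP_cvg g t l : is_derive t (1 : R) g l <->
  (fun h => h^-1 * (g (t + h) - g t)) @ 0^' --> l.
Proof.
have E : (fun h => h^-1 * (g (t + h) - g t)) =
    (fun h => h^-1 *: ((g \o shift t) (h *: 1) - g t)).
  by apply/funext => h /=; rewrite [h *: 1]mulr1 [h + t]addrC.
rewrite E; split=> [[d <-]|H]; first exact: d.
have d : derivable g t 1.
  by apply/cvg_ex; exists l.
by apply: (DeriveDef d); apply: cvg_lim.
Qed.

Lemma derive_at_shift g t l :
  is_derive (0 : R) (1 : R) (fun s => g (t + s)) l -> is_derive t (1 : R) g l.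
Proof.
move=> /deriveP_cvg H; apply/deriveP_cvg; apply: cvg_trans H.
by apply: near_eq_cvg; apply: nearW => h; rewrite add0r addr0.
Qed.

Lemma derive_cvg0 g t l : is_derive t (1 : R) g l -> g x @[x --> t] --> g t.
Proof.
by move=> [d _]; apply: differentiable_continuous; apply/derivable1_diffP.
Qed.

Lemma mvt_bound (phi psi : R -> R) (T l e : R) :
  (forall t, `|t| <= `|T| -> is_derive t (1 : R) phi (psi t)) ->
  (forall t, `|t| <= `|T| -> `|psi t - l| <= e) ->
  `|phi T - phi 0 - l * T| <= e * `|T|.
Proof.
move=> dphi bpsi.
have key a b : a <= b -> `|a| <= `|T| -> `|b| <= `|T| ->
    `|phi b - phi a - l * (b - a)| <= e * (b - a).
  move=> ab aT bT.
  have inT x : x \in `[a, b] -> `|x| <= `|T|.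
    rewrite in_itv /= => /andP[ax xb].
    by move: aT bT; rewrite !ler_norml => /andP[? _] /andP[_ ?]; apply/andP; lra.
  have [||c cab ->] := MVT_segment (df := psi) (f := phi) ab.
  - by move=> x /subset_itv_oo_cc/inT; exact: dphi.
  - apply: continuous_in_subspaceT => x; rewrite inE => /inT/dphi.
    exact: derive_cvg0.
  rewrite -mulrBl normrM (ger0_norm (x := b - a)) ?subr_ge0//.
  by apply: ler_wpM2r; rewrite ?subr_ge0//; exact/bpsi/inT.
have [T0|T0] := leP 0 T.
  by have := key 0 T T0; rewrite normr0 subr0 (ger0_norm T0); apply.
have := key T 0 (ltW T0); rewrite normr0 => /(_ (lexx _) (normr_ge0 _)).
rewrite sub0r (ltr0_norm T0) -normrN; congr (`|_| <= _); ring.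
Qed.

Lemma derive0_cst01 (phi : R -> R) :
  (forall t : R, 0 <= t <= 1 -> is_derive t (1 : R) phi 0) ->
  forall t, 0 <= t <= 1 -> phi t = phi 0.
Proof.
move=> d t /andP[t0 t1].
have inT x : x \in `[0, t] -> 0 <= x <= 1 by rewrite in_itv /=; lra.
have [||c _] := MVT_segment (df := fun=> 0) (f := phi) t0; last lra.
- by move=> x /subset_itv_oo_cc/inT; exact: d.
- apply: continuous_in_subspaceT => x; rewrite inE => /inT/d.
  exact: derive_cvg0.
Qed.

Lemma nbhs0_lt (P : R -> Prop) :
  (\forall x \near (0 : R), P x) <-> exists2 d : R, 0 < d & forall x, `|x| < d -> P x.
Proof.
split=> [/nbhs_ballP[d /= d0 dP]|[d d0 dP]].
  by exists d => // x xd; apply: dP; rewrite /ball /= sub0r normrN.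
by apply/nbhs_ballP; exists d => //= x; rewrite /ball /= sub0r normrN; exact: dP.
Qed.

Lemma cvg_dnbhs0 g (l : R) : g x @[x --> 0^'] --> l <->
  forall e : R, 0 < e -> exists2 d : R, 0 < d &
    forall x, `|x| < d -> x != 0 -> `|g x - l| <= e.
Proof.
split=> [/cvgrPdist_le H e /H|H].
  by rewrite near_withinE => /nbhs0_lt[d d0 dP]; exists d => // x xd x0;
    rewrite distrC; exact: dP.
apply/cvgrPdist_le => e /H[d d0 dP]; rewrite near_withinE; apply/nbhs0_lt.
by exists d => // x xd x0; rewrite distrC; exact: dP.
Qed.

Lemma derive_mulid (g : R -> R) l : g x @[x --> 0^'] --> l ->
  is_derive (0 : R) (1 : R) (fun t => t * g t) l.
Proof.
move=> gl; apply/deriveP_cvg; apply: cvg_trans gl; apply: near_eq_cvg.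
rewrite near_withinE; apply: nearW => x x0.
by rewrite add0r mul0r subr0 mulKf.
Qed.

(** Apply the mean value inequality to phi - c t^2, whose derivative is o(t). *)
Lemma peano2 (phi psi : R -> R) (c : R) :
  phi 0 = 0 ->
  (\forall t \near (0 : R), is_derive t (1 : R) phi (psi t)) ->
  psi t / t @[t --> 0^'] --> 2 * c -> psi 0 = 0 ->
  phi t / t ^+ 2 @[t --> 0^'] --> c.
Proof.
move=> phi0 /nbhs0_lt[d d0 dphi] /cvg_dnbhs0 psic psi0.
apply/cvg_dnbhs0 => e e0; have [d' d'0 psile] := psic e e0.
exists (Num.min d d'); first by rewrite lt_min d0.
move=> T; rewrite lt_min => /andP[Td Td'] T0.
have := @mvt_bound (fun t => phi t - c * (t * t))
  (fun t => psi t - 2 * c * t) T 0 (e * `|T|).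
rewrite phi0 !mulr0 subr0 mul0r !subr0 => H.
have {}H : `|phi T - c * (T * T)| <= e * `|T| * `|T|.
  apply: H => t tT.
    have dt := dphi _ (le_lt_trans tT Td).
    apply: is_derive_eq; rewrite /GRing.scale /=; ring.
  rewrite subr0; have [->|t0] := eqVneq t 0.
    by rewrite psi0 mulr0 subr0 normr0 mulr_ge0 // ltW.
  have := psile _ (le_lt_trans tT Td') t0.
  have -> : psi t / t - 2 * c = (psi t - 2 * c * t) / t by field.
  rewrite normrM normfV ler_pdivrMr ?normr_gt0 // => /le_trans; apply.
  by rewrite ler_wpM2l// ltW.
have -> : phi T / T ^+ 2 - c = (phi T - c * (T * T)) / T ^+ 2 by field.
rewrite normrM normfV normrX ler_pdivrMr ?exprn_gt0 ?normr_gt0//.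
by rewrite expr2 [e * _]mulrA.
Qed.

(** The limit s -> 0 commutes with d/dt without any mixed second derivative: by the
mean value inequality, the increments of [phi s / s] in t are controlled by
[psi s / s], uniformly for small s. *)
Lemma derive_lim (phi psi : R -> R -> R) (w : R -> R) (l : R) :
  (\forall s \near (0 : R)^' & t \near (0 : R),
     is_derive t (1 : R) (phi s) (psi s t)) ->
  (fun x : R * R => x.1^-1 * psi x.1 x.2) @ ((0 : R)^', nbhs (0 : R)) --> l ->
  (\forall t \near (0 : R), s^-1 * phi s t @[s --> 0^'] --> w t) ->
  is_derive (0 : R) (1 : R) w l.
Proof.
move=> dphi psil phiw; apply/deriveP_cvg/cvg_dnbhs0 => e e0.
move/nbhs0_lt: phiw => [d1 d10 phiw].
move/cvgrPdist_le: psil => /(_ e e0) psil.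
have [[A B] /= [A0 B0] AB] := filterI dphi psil.
move/nbhs0_lt: B0 => [d2 d20 B0].
exists (Num.min d1 d2); first by rewrite lt_min d10.
move=> T; rewrite lt_min => /andP[Td1 Td2] T0; rewrite add0r.
have -> : T^-1 * (w T - w 0) - l = (w T - w 0 - l * T) / T by field.
rewrite normrM normfV ler_pdivrMr ?normr_gt0//.
have w0 : s^-1 * phi s 0 @[s --> 0^'] --> w 0 by apply: phiw; rewrite normr0.
have wT := phiw _ Td1.
have wl : (fun s => `|s^-1 * phi s T - s^-1 * phi s 0 - l * T|) @ (0 : R)^'
    --> `|w T - w 0 - l * T|.
  by apply: cvg_norm; apply: cvgB; [exact: cvgB|exact: cvg_cst].
apply: (closed_cvg (fun x : R => x <= e * `|T|) _ _ _ wl).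
  exact: closed_le.
near=> s.
have As : A s by near: s.
apply: (@mvt_bound (fun t => s^-1 * phi s t) (fun t => s^-1 * psi s t)) => t tT.
  have [//|d _] := AB (s, t); first by split => //=; apply: B0; apply: le_lt_trans Td2.
  apply: is_derive_eq; rewrite /GRing.scale /=; ring.
rewrite distrC.
by have [|_ //] := AB (s, t); split => //=; apply: B0; apply: le_lt_trans Td2.
Unshelve. all: by end_near. Qed.

End RealCalculus.

(** * The group and its Lie algebra *)

Section Algebra.
Context {R : realType}.
Local Notation V := 'rV[R]_5.
Implicit Types (p q U W : V) (a b s t : R).

(** The coordinates are exponential, so this is a horizontal vector at 0 as well as
the group element it generates. *)
Definition hv a b : V := vec5 a b 0 0 0.

Definition wedge p q : R := cx1 p * cx2 q - cx2 p * cx1 q.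

(** The value at [p] of the left-invariant vector field equal to [W] at 0. *)
Definition lft W p : V :=
  vec5 (cx1 W) (cx2 W) (cy W + 2^-1 * wedge p W)
    (cz1 W + 2^-1 * (cx1 p * cy W - cy p * cx1 W) + 12^-1 * cx1 p * wedge p W)
    (cz2 W + 2^-1 * (cx2 p * cy W - cy p * cx2 W) + 12^-1 * cx2 p * wedge p W).

(** The Lie bracket, in the coordinates of the tangent space at 0. *)
Definition bracket U W : V :=
  vec5 0 0 (wedge U W) (cx1 U * cy W - cy U * cx1 W)
    (cx2 U * cy W - cy U * cx2 W).

Definition dilation (r : R) p : V :=
  vec5 (r * cx1 p) (r * cx2 p) (r ^+ 2 * cy p) (r ^+ 3 * cz1 p) (r ^+ 3 * cz2 p).

Lemma vec5_inj p q : cx1 p = cx1 q -> cx2 p = cx2 q -> cy p = cy q ->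
  cz1 p = cz1 q -> cz2 p = cz2 q -> p = q.
Proof.
by move=> e1 e2 e3 e4 e5; rewrite (vec5_eta p) (vec5_eta q) e1 e2 e3 e4 e5.
Qed.

Lemma ord5P (P : 'I_5 -> Prop) : P 0 -> P 1 -> P 2 -> P 3 -> P 4 -> forall j, P j.
Proof.
move=> P0 P1 P2 P3 P4 [[|[|[|[|[|//]]]]] lt].
- by rewrite (_ : Ordinal lt = 0)//; apply/val_inj.
- by rewrite (_ : Ordinal lt = 1)//; apply/val_inj.
- by rewrite (_ : Ordinal lt = 2)//; apply/val_inj.
- by rewrite (_ : Ordinal lt = 3)//; apply/val_inj.
- by rewrite (_ : Ordinal lt = 4)//; apply/val_inj.
Qed.

Lemma coordD p q : (cx1 (p + q) = cx1 p + cx1 q) * (cx2 (p + q) = cx2 p + cx2 q) *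
  (cy (p + q) = cy p + cy q) * (cz1 (p + q) = cz1 p + cz1 q) *
  (cz2 (p + q) = cz2 p + cz2 q).
Proof. by rewrite /cx1 /cx2 /cy /cz1 /cz2 !mxE. Qed.

Lemma coordN p : (cx1 (- p) = - cx1 p) * (cx2 (- p) = - cx2 p) *
  (cy (- p) = - cy p) * (cz1 (- p) = - cz1 p) * (cz2 (- p) = - cz2 p).
Proof. by rewrite /cx1 /cx2 /cy /cz1 /cz2 !mxE. Qed.

Lemma coordZ a p : (cx1 (a *: p) = a * cx1 p) * (cx2 (a *: p) = a * cx2 p) *
  (cy (a *: p) = a * cy p) * (cz1 (a *: p) = a * cz1 p) *
  (cz2 (a *: p) = a * cz2 p).
Proof. by rewrite /cx1 /cx2 /cy /cz1 /cz2 !mxE. Qed.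

Lemma coord0 : (cx1 (0 : V) = 0) * (cx2 (0 : V) = 0) *
  (cy (0 : V) = 0) * (cz1 (0 : V) = 0) * (cz2 (0 : V) = 0).
Proof. by rewrite /cx1 /cx2 /cy /cz1 /cz2 !mxE. Qed.

Definition coordE := (@vec5E R, coordD, coordN, coordZ, coord0).

Ltac vec5_field :=
  apply: vec5_inj;
  rewrite /cartan_mul /lft /bracket /dilation /wedge /hv /X1 /X2 /= ?coordE; by field.

Lemma mul0 p : p ** 0 = p.
Proof. vec5_field. Qed.

Lemma mulVK p q : (- p) ** (p ** q) = q.
Proof. vec5_field. Qed.

Lemma mulKV p q : p ** ((- p) ** q) = q.
Proof. vec5_field. Qed.

Lemma mul_line p W s t : p ** (s *: W) ** (t *: W) = p ** ((s + t) *: W).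
Proof. vec5_field. Qed.

Lemma mul_conj p W a b s t : let U := hv a b in
  p ** (s *: W) ** (t *: U) =
  p ** (t *: U) ** (s *: (W - t *: bracket U W + (t ^+ 2 / 2) *: bracket U (bracket U W))).
Proof. vec5_field. Qed.

Lemma lftD W W' p : lft (W + W') p = lft W p + lft W' p.
Proof. vec5_field. Qed.

Lemma lftZ a W p : lft (a *: W) p = a *: lft W p.
Proof. vec5_field. Qed.

Lemma lft_hv a b p : lft (hv a b) p = a *: X1 p + b *: X2 p.
Proof. vec5_field. Qed.

Lemma dilationM r p q : dilation r (p ** q) = dilation r p ** dilation r q.
Proof. vec5_field. Qed.

End Algebra.

(** * Limits in the group *)

(* Matching the head symbol first avoids costly failed unifications. *)
Ltac cvg_poly := repeat
  lazymatch goal with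
  | |- context [fmap (fun _ => ?c)] => exact: cvg_cst
  | |- context [fmap (fun x => _ + _)] => apply: cvgD
  | |- context [fmap (fun x => - _)] => apply: cvgN
  | |- context [fmap (fun x => _ * _)] => apply: cvgM
  | |- _ => assumption
  end.

Section Limits.
Context {R : realType}.
Local Notation V := 'rV[R]_5.

Lemma cvg_coord (T : Type) (F : set_system T) {FF : Filter F} (g : T -> V) l :
  g @ F --> l ->
  [/\ cx1 (g x) @[x --> F] --> cx1 l, cx2 (g x) @[x --> F] --> cx2 l,
      cy (g x) @[x --> F] --> cy l, cz1 (g x) @[x --> F] --> cz1 l &
      cz2 (g x) @[x --> F] --> cz2 l].
Proof.
move=> gl; have H j : g x 0 j @[x --> F] --> l 0 j.
  exact: (cvg_comp _ _ gl (@coord_continuous R 1 5 0 j l)).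
by split; exact: H.
Qed.

Lemma cvg_vec5 (T : Type) (F : set_system T) {FF : Filter F} (g : T -> V) l :
  cx1 (g x) @[x --> F] --> cx1 l -> cx2 (g x) @[x --> F] --> cx2 l ->
  cy (g x) @[x --> F] --> cy l -> cz1 (g x) @[x --> F] --> cz1 l ->
  cz2 (g x) @[x --> F] --> cz2 l -> g @ F --> l.
Proof.
move=> H0 H1 H2 H3 H4.
have {H0 H1 H2 H3 H4}H : forall j, g x 0 j @[x --> F] --> l 0 j.
  by apply: ord5P.
apply/cvgrPdist_le => /= e e0; near=> x.
rewrite /Num.Def.normr/= mx_normrE (bigmax_le _ (ltW e0))//= => i _.
rewrite !mxE/= ord1; move: i.2; near: x; apply: filter_forall => /= j.
by have /cvgrPdist_le := H j; exact.
Unshelve. all: by end_near. Qed.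

Lemma cvg_mulg (T : Type) (F : set_system T) {FF : Filter F} (g h : T -> V) p q :
  g @ F --> p -> h @ F --> q -> (fun x => g x ** h x) @ F --> p ** q.
Proof.
move=> /cvg_coord[? ? ? ? ?] /cvg_coord[? ? ? ? ?].
apply: cvg_vec5; rewrite /cartan_mul; rewrite ?coordE;
  under eq_fun do rewrite ?coordE; cvg_poly.
Qed.

Lemma cvg_lft (T : Type) (F : set_system T) {FF : Filter F} (g h : T -> V) p q :
  g @ F --> p -> h @ F --> q -> (fun x => lft (g x) (h x)) @ F --> lft p q.
Proof.
move=> /cvg_coord[? ? ? ? ?] /cvg_coord[? ? ? ? ?].
apply: cvg_vec5; rewrite /lft /wedge; rewrite ?coordE;
  under eq_fun do rewrite ?coordE; cvg_poly.
Qed.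

End Limits.

(** * Differentials in left-invariant frames *)

Section Variation.
Context {R : realType}.
Local Notation V := 'rV[R]_5.

(** The value of the left-invariant frame is factored out of the differential, so that
[m W] is a continuous function with values in one fixed vector space. *)
Record left_differential (Om : set V) (f : V -> V) (m : V -> V -> V) : Prop := {
  ld_derive : forall q W j, Om q ->
    is_derive (0 : R) (1 : R) (fun s => f (q ** (s *: W)) 0 j)
      (lft (m W q) (f q) 0 j);
  ld_linear : forall a U W q, Om q -> m (a *: U + W) q = a *: m U q + m W q;
  ld_cvg : forall q W, Om q -> m W @ q --> m W q;
  ld_cvgf : forall q, Om q -> f @ q --> f q }.

Record contact_differential (Om : set V) (f : V -> V) (m : V -> V -> V) : Prop := {
  cd_left : left_differential Om f m;
  cd_horizontal : forall q a b, Om q ->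
    m (hv a b) q = hv (cx1 (m (hv a b) q)) (cx2 (m (hv a b) q));
  cd_nondegenerate : forall q, Om q ->
    wedge (m (hv 1 0) q) (m (hv 0 1) q) != 0 }.

Context (Om : set V) (openOm : open Om) (f : V -> V) (m : V -> V -> V).
Context (ld : left_differential Om f m).

(** The series of exp(- t ad (hv a b)), which stops because the group has step 3. *)
Definition Ad (a b t : R) (W : V) : V :=
  W - t *: bracket (hv a b) W + (t ^+ 2 / 2) *: bracket (hv a b) (bracket (hv a b) W).

Lemma line_cvg q W : q ** (t *: W) @[t --> (0 : R)] --> q.
Proof.
rewrite -[X in _ --> X]mul0; apply: cvg_mulg; first exact: cvg_cst.
by rewrite -(scale0r W); apply: cvgZr_tmp; exact: cvg_id.
Qed.

Lemma near_line q W : Om q -> \forall t \near (0 : R), Om (q ** (t *: W)).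
Proof.
by move=> Oq; exact: (@line_cvg q W _ (open_nbhs_nbhs (conj openOm Oq))).
Qed.

Lemma left_derive q W : Om q ->
  [/\ is_derive (0 : R) (1 : R) (fun s => cx1 (f (q ** (s *: W)))) (cx1 (lft (m W q) (f q))),
      is_derive (0 : R) (1 : R) (fun s => cx2 (f (q ** (s *: W)))) (cx2 (lft (m W q) (f q))),
      is_derive (0 : R) (1 : R) (fun s => cy (f (q ** (s *: W)))) (cy (lft (m W q) (f q))),
      is_derive (0 : R) (1 : R) (fun s => cz1 (f (q ** (s *: W)))) (cz1 (lft (m W q) (f q))) &
      is_derive (0 : R) (1 : R) (fun s => cz2 (f (q ** (s *: W)))) (cz2 (lft (m W q) (f q)))].
Proof. by move=> Oq; split; exact: (ld_derive ld). Qed.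

Lemma derive_line (g : V -> R) q W t l :
  is_derive (0 : R) (1 : R) (fun s => g (q ** (t *: W) ** (s *: W))) l ->
  is_derive t (1 : R) (fun t => g (q ** (t *: W))) l.
Proof.
move=> H; apply: derive_at_shift.
by under eq_fun do rewrite -mul_line.
Qed.

(** Moving along the flow of W and then along a line is moving along the line and
then along the conjugate of W: this is how the variation of a line is differentiated. *)
Lemma derive_conj (g : V -> R) q W a b s t l :
  is_derive (0 : R) (1 : R)
    (fun h => g (q ** (s *: W) ** (t *: hv a b) ** (h *: Ad a b t W))) l ->
  is_derive s (1 : R) (fun s => g (q ** (s *: W) ** (t *: hv a b))) l.
Proof.
move=> H; apply: derive_at_shift.
by under eq_fun do rewrite -mul_line mul_conj.
Qed.

Lemma ldD W U q : Om q -> m (W + U) q = m W q + m U q.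
Proof. by move=> Oq; have := ld_linear ld 1 W U Oq; rewrite !scale1r. Qed.

Lemma ldZ a W q : Om q -> m (a *: W) q = a *: m W q.
Proof.
move=> Oq; have m0 : m 0 q = 0.
  have := ldD 0 0 Oq; rewrite addr0 => /eqP.
  by rewrite -subr_eq subrr eq_sym => /eqP.
by have := ld_linear ld a W 0 Oq; rewrite m0 !addr0.
Qed.

Lemma m_Ad a b t W q : Om q -> m (Ad a b t W) q =
  m W q - t *: m (bracket (hv a b) W) q
    + (t ^+ 2 / 2) *: m (bracket (hv a b) (bracket (hv a b) W)) q.
Proof.
by move=> Oq; rewrite /Ad ldD// ldZ// ldD// -scaleN1r ldZ// ldZ// scaleN1r.
Qed.

(** The plaque through q: short horizontal lines starting on a transverse ray. *)
Lemma plaque_cvg q W U : (fun x : R * R => q ** (x.1 *: W) ** (x.2 *: U)) @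
  (nbhs (0 : R), nbhs (0 : R)) --> q.
Proof.
rewrite -[X in _ --> X]mul0 -[X in _ --> X ** _]mul0.
have c1 : (fun x : R * R => x.1 *: W) @ (nbhs (0 : R), nbhs (0 : R)) --> (0 : V).
  by rewrite -[X in _ --> X](scale0r W); apply: cvgZr_tmp; exact: cvg_fst.
have c2 : (fun x : R * R => x.2 *: U) @ (nbhs (0 : R), nbhs (0 : R)) --> (0 : V).
  by rewrite -[X in _ --> X](scale0r U); apply: cvgZr_tmp; exact: cvg_snd.
apply: cvg_mulg => //; apply: cvg_mulg => //; exact: cvg_cst.
Qed.

Lemma near_plaque q W U : Om q ->
  \forall x \near (nbhs (0 : R), nbhs (0 : R)), Om (q ** (x.1 *: W) ** (x.2 *: U)).
Proof. by move=> Oq; exact: (@plaque_cvg q W U _ (open_nbhs_nbhs (conj openOm Oq))). Qed.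

(** Continuity of [m], uniform near the base point of the plaque, because Ad is a
polynomial in t. *)
Lemma m_Ad_cvg q W a b : Om q ->
  (fun x : R * R => m (Ad a b x.2 W) (q ** (x.1 *: W) ** (x.2 *: hv a b))) @
  (nbhs (0 : R), nbhs (0 : R)) --> m W q.
Proof.
move=> Oq; have mc U := cvg_comp _ _ (@plaque_cvg q W (hv a b)) (@ld_cvg _ _ _ ld q U Oq).
have c2 : (fun x : R * R => x.2) @ (nbhs (0 : R), nbhs (0 : R)) --> (0 : R).
  exact: cvg_snd.
have E : \forall x \near (nbhs (0 : R), nbhs (0 : R)),
    (fun x : R * R => let q' := q ** (x.1 *: W) ** (x.2 *: hv a b) in
       m W q' - x.2 *: m (bracket (hv a b) W) q'
       + (x.2 ^+ 2 / 2) *: m (bracket (hv a b) (bracket (hv a b) W)) q') x =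
    m (Ad a b x.2 W) (q ** (x.1 *: W) ** (x.2 *: hv a b)).
  by near=> x; apply/esym/m_Ad; near: x; exact: near_plaque.
apply: (cvg_trans (near_eq_cvg E)).
have -> : m W q = m W q - (0 : R) *: m (bracket (hv a b) W) q
    + ((0 : R) ^+ 2 / 2) *: m (bracket (hv a b) (bracket (hv a b) W)) q.
  by rewrite expr0n /= mul0r !scale0r subr0 addr0.
apply: cvgD; first apply: cvgB; first exact: mc.
  by apply: cvgZ => //; exact: mc.
apply: cvgZ; last exact: mc.
by apply: cvgM; [exact: cvgM|exact: cvg_cst].
Unshelve. all: by end_near. Qed.

End Variation.

Section DifferenceQuotients.
Context {R : realType}.
Local Notation V := 'rV[R]_5.
Context (Om : set V) (openOm : open Om) (f : V -> V) (m : V -> V -> V).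
Context (ld : left_differential Om f m).

(** Joint limit in (s, t), as needed in [derive_lim]: the mean value inequality in s
reduces it to the continuity of the differential. *)
Lemma quotient_cvg q W a b j : Om q ->
  (fun x : R * R => x.1^-1 * (f (q ** (x.1 *: W) ** (x.2 *: hv a b)) 0 j
                             - f (q ** (x.2 *: hv a b)) 0 j)) @
  ((0 : R)^', nbhs (0 : R)) --> lft (m W q) (f q) 0 j.
Proof.
move=> Oq; set l := lft _ _ 0 j.
pose psi (x : R * R) := let q' := q ** (x.1 *: W) ** (x.2 *: hv a b) in
  lft (m (Ad a b x.2 W) q') (f q') 0 j.
have psil : psi @ (nbhs (0 : R), nbhs (0 : R)) --> l.
  have c := @cvg_lft R _ _ _ _ _ _ _ (@m_Ad_cvg _ _ openOm _ _ ld q W a b Oq)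
    (cvg_comp _ _ (@plaque_cvg R q W (hv a b)) (ld_cvgf ld Oq)).
  exact: (cvg_comp _ _ (c _) (@coord_continuous R 1 5 0 j (lft (m W q) (f q)))).
apply/cvgrPdist_le => e e0.
move/cvgrPdist_le: psil => /(_ e e0) psile.
have [[A B] /= [A0 B0] AB] := filterI psile (@near_plaque _ _ openOm q W (hv a b) Oq).
move/nbhs0_lt: A0 => [d d0 dA].
have A'0 : (0 : R)^' [set s : R | `|s| < d /\ s != 0].
  by rewrite /dnbhs /within /=; apply/nbhs0_lt; exists d.
exists ([set s | `|s| < d /\ s != 0], B); first by split.
move=> [s t] /= [[sd s0] Bt].
have := @mvt_bound _ (fun s => f (q ** (s *: W) ** (t *: hv a b)) 0 j)
  (fun s => psi (s, t)) s l e.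
rewrite scale0r mul0 => H; rewrite distrC.
have -> : s^-1 * (f (q ** (s *: W) ** (t *: hv a b)) 0 j
    - f (q ** (t *: hv a b)) 0 j) - l
  = (f (q ** (s *: W) ** (t *: hv a b)) 0 j
    - f (q ** (t *: hv a b)) 0 j - l * s) / s by field.
rewrite normrM normfV ler_pdivrMr ?normr_gt0//; apply: H => s' s's.
  apply: (derive_conj (g := fun q => f q 0 j)); apply: (ld_derive ld).
  by have [|//] := AB (s', t); split => //=; apply: dA; apply: le_lt_trans sd.
rewrite distrC.
by have [|//] := AB (s', t); split => //=; apply: dA; apply: le_lt_trans sd.
Qed.

End DifferenceQuotients.

(** * Variation of horizontal lines *)

Section ContactEquations.
Context {R : realType}.
Local Notation V := 'rV[R]_5.
Context (Om : set V) (openOm : open Om) (f : V -> V) (m : V -> V -> V).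
Context (cd : contact_differential Om f m).
Let ld := cd_left cd.

(** The pairs (x1, x2) and (z1, z2) obey the same formulas; the index treats both at
once. *)
Definition sx (i : bool) (p : V) : R := if i then cx2 p else cx1 p.
Definition sz (i : bool) (p : V) : R := if i then cz2 p else cz1 p.

(** The image of a horizontal line is a horizontal curve, so its y- and z-velocities are
determined by its position and its x-velocity. *)
Lemma horizontal_derive q a b t : Om (q ** (t *: hv a b)) ->
  let p := q ** (t *: hv a b) in let w := m (hv a b) p in
  [/\ forall i, is_derive t (1 : R) (fun t => sx i (f (q ** (t *: hv a b)))) (sx i w),
      is_derive t (1 : R) (fun t => cy (f (q ** (t *: hv a b))))
        (2^-1 * wedge (f p) w) &
      forall i, is_derive t (1 : R) (fun t => sz i (f (q ** (t *: hv a b))))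
        (- (2^-1 * cy (f p) * sx i w) + 12^-1 * sx i (f p) * wedge (f p) w)].
Proof.
move=> Op p w.
have [d0 d1 d2 d3 d4] := left_derive ld (hv a b) Op.
have E : w = hv (cx1 w) (cx2 w) by exact: (cd_horizontal cd).
have [E3 E4 E5] : [/\ cy w = 0, cz1 w = 0 & cz2 w = 0].
  by rewrite E /hv !coordE.
rewrite -/p -/w in d0 d1 d2 d3 d4.
split=> [i||i].
- apply: (derive_line (g := fun q => sx i (f q))).
  by case: i; [apply: (is_derive_eq d1)|apply: (is_derive_eq d0)];
    rewrite /lft /= !coordE.
- apply: (derive_line (g := fun q => cy (f q))).
  by apply: (is_derive_eq d2); rewrite /lft /= !coordE E3 add0r.
- apply: (derive_line (g := fun q => sz i (f q))).
  by case: i; [apply: (is_derive_eq d4)|apply: (is_derive_eq d3)];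
    rewrite /lft /= !coordE E3 ?E4 ?E5; field.
Qed.

Section AtPoint.
Context (q W : V) (Oq : Om q) (a b : R).
Local Notation U := (hv a b).
Let pt s t := q ** (s *: W) ** (t *: U).
Let F2 : set_system (R * R) := filter_prod (0 : R)^' (nbhs (0 : R)).

Let pt0 t : pt 0 t = q ** (t *: U).
Proof. by rewrite /pt scale0r mul0. Qed.

Let toF2 : F2 `=>` filter_prod (nbhs (0 : R)) (nbhs (0 : R)).
Proof.
move=> A [[B C] /= [B0 C0] BC]; exists (B, C) => //=; split=> //.
exact: nbhs_dnbhs.
Qed.

Let pt_cvg : (fun x : R * R => pt x.1 x.2) @ F2 --> q.
Proof. exact: (cvg_trans (cvg_app _ toF2) (@plaque_cvg R q W U)). Qed.

Let pt0_cvg : (fun x : R * R => pt 0 x.2) @ F2 --> q.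
Proof.
under eq_fun do rewrite pt0.
exact: (cvg_comp _ _ cvg_snd (@line_cvg R q U)).
Qed.

Let near_pt : \forall x \near F2, Om (pt x.1 x.2) /\ Om (pt 0 x.2).
Proof.
near=> x; split; near: x.
  exact: (pt_cvg (open_nbhs_nbhs (conj openOm Oq))).
exact: (pt0_cvg (open_nbhs_nbhs (conj openOm Oq))).
Unshelve. all: by end_near. Qed.

Let quotient i :
  (fun x : R * R => x.1^-1 * (sx i (f (pt x.1 x.2)) - sx i (f (pt 0 x.2)))) @ F2
    --> sx i (m W q).
Proof.
have H j : (fun x : R * R => x.1^-1 * (f (pt x.1 x.2) 0 j - f (pt 0 x.2) 0 j)) @ F2
    --> lft (m W q) (f q) 0 j.
  under eq_fun do rewrite pt0.
  exact: (@quotient_cvg _ _ openOm _ _ ld q W a b j Oq).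
have -> : sx i (m W q) = sx i (lft (m W q) (f q)).
  by case: i; rewrite /= /lft !coordE.
by case: i; exact: H.
Qed.

Let vel_cvg i : sx i (m U (pt x.1 x.2)) @[x --> F2] --> sx i (m U q).
Proof.
have /cvg_coord[c1 c2 _ _ _] := cvg_comp _ _ pt_cvg (@ld_cvg _ _ _ _ ld q U Oq).
by case: i.
Qed.

Let vel0_cvg i : sx i (m U (pt 0 x.2)) @[x --> F2] --> sx i (m U q).
Proof.
have /cvg_coord[c1 c2 _ _ _] := cvg_comp _ _ pt0_cvg (@ld_cvg _ _ _ _ ld q U Oq).
by case: i.
Qed.

Let pos_cvg i : sx i (f (pt x.1 x.2)) @[x --> F2] --> sx i (f q).
Proof.
have /cvg_coord[c1 c2 _ _ _] := cvg_comp _ _ pt_cvg (ld_cvgf ld Oq).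
by case: i.
Qed.

Let pos0_cvg i : sx i (f (pt 0 x.2)) @[x --> F2] --> sx i (f q).
Proof.
have /cvg_coord[c1 c2 _ _ _] := cvg_comp _ _ pt0_cvg (ld_cvgf ld Oq).
by case: i.
Qed.

(* The y- and z-coordinates of f(pt 0 t)^-1 * f(pt s t). *)
Let dy s t := cy (f (pt s t)) - cy (f (pt 0 t)) - 2^-1 * wedge (f (pt 0 t)) (f (pt s t)).
Let dz i s t := sz i (f (pt s t)) - sz i (f (pt 0 t))
  - 2^-1 * (sx i (f (pt 0 t)) * cy (f (pt s t)) - cy (f (pt 0 t)) * sx i (f (pt s t)))
  + 12^-1 * (sx i (f (pt 0 t)) + sx i (f (pt s t))) * wedge (f (pt 0 t)) (f (pt s t)).
Let dx i s t := sx i (f (pt s t)) - sx i (f (pt 0 t)).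
Let vs i s t := sx i (m U (pt s t)) + sx i (m U (pt 0 t)).
Let vd i s t := sx i (m U (pt s t)) - sx i (m U (pt 0 t)).

(* Their t-derivatives, computed from the horizontality of both curves. *)
Let dy' s t := 2^-1 * (dx false s t * vs true s t - dx true s t * vs false s t).
Let dz' i s t := - (2^-1 * dy s t * vs i s t)
  + 12^-1 * dx i s t * (dx false s t * vd true s t - dx true s t * vd false s t).

Let pt_derive s t : Om (pt s t) -> Om (pt 0 t) ->
  is_derive t (1 : R) (dy s) (dy' s t) /\
  forall i, is_derive t (1 : R) (dz i s) (dz' i s t).
Proof.
move=> O1; rewrite pt0 => O2.
have [x1 y1 z1] := horizontal_derive O1.
have [x2 y2 z2] := horizontal_derive O2.
have := x1 true; have := x1 false; have := x2 true; have := x2 false.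
rewrite /sx => ? ? ? ?.
rewrite /dy /dy' /dz /dz' /dy /dx /vs /vd /wedge /pt.
rewrite scale0r !mul0.
split=> [|i].
  by apply: is_derive_eq; rewrite /GRing.scale /= /wedge; field.
have := z1 i; have := z2 i; case: i; rewrite /sx /sz => ? ?;
  by apply: is_derive_eq; rewrite /GRing.scale /= /wedge; field.
Qed.

Let w t := m (Ad a b t W) (q ** (t *: U)).

Let d_cvg t : Om (q ** (t *: U)) ->
  s^-1 * dy s t @[s --> (0 : R)^'] --> cy (w t) /\
  forall i, s^-1 * dz i s t @[s --> (0 : R)^'] --> sz i (w t).
Proof.
move=> Ot; have [d0 d1 d2 d3 d4] := left_derive ld (Ad a b t W) Ot.
rewrite -/(w t) in d0 d1 d2 d3 d4.
have D (g : V -> R) l : is_derive (0 : R) (1 : R)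
    (fun h => g (f (q ** (t *: U) ** (h *: Ad a b t W)))) l ->
    is_derive (0 : R) (1 : R) (fun s => g (f (pt s t))) l.
  move=> H; apply: (derive_conj (g := fun q => g (f q))).
  by rewrite scale0r mul0.
have {}d0 := D cx1 _ d0; have {}d1 := D cx2 _ d1; have {}d2 := D cy _ d2.
have {}d3 := D cz1 _ d3; have {}d4 := D cz2 _ d4.
have L (g : R -> R) l : g 0 = 0 -> is_derive (0 : R) (1 : R) g l ->
    s^-1 * g s @[s --> (0 : R)^'] --> l.
  by move=> g0 /deriveP_cvg; rewrite g0; under eq_fun do rewrite add0r subr0.
split=> [|i]; apply: L.
- by rewrite /dy /wedge; field.
- rewrite /dy /wedge.
  by apply: is_derive_eq; rewrite /GRing.scale /= /lft /wedge pt0 !coordE; field.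
- by rewrite /dz /wedge; field.
- by rewrite /dz /wedge; case: i; rewrite /sx /sz;
    apply: is_derive_eq; rewrite /GRing.scale /= /lft /wedge pt0 !coordE; field.
Qed.

Let near_derive : \forall s \near (0 : R)^' & t \near (0 : R),
  is_derive t (1 : R) (dy s) (dy' s t) /\
  forall i, is_derive t (1 : R) (dz i s) (dz' i s t).
Proof.
by apply: filterS near_pt; case=> s t /= [in1 in2]; exact: pt_derive.
Qed.

Let near_d_cvg : \forall t \near (0 : R),
  s^-1 * dy s t @[s --> (0 : R)^'] --> cy (w t) /\
  forall i, s^-1 * dz i s t @[s --> (0 : R)^'] --> sz i (w t).
Proof. by apply: filterS (near_line openOm U Oq); exact: d_cvg. Qed.

(** [dy s t] is differentiable in t with a derivative that contains only x-velocities,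
since both curves are horizontal; divided by s it tends to the y-component of the
variation, and [derive_lim] applies. *)
Lemma variation_y : is_derive (0 : R) (1 : R)
  (fun t => cy (m (Ad a b t W) (q ** (t *: U)))) (wedge (m W q) (m U q)).
Proof.
apply: (derive_lim (phi := dy) (psi := dy')).
- by apply: filterS near_derive; move=> x [].
- have E : (fun x : R * R => x.1^-1 * dy' x.1 x.2) = (fun x : R * R => 2^-1 *
    ((x.1^-1 * (sx false (f (pt x.1 x.2)) - sx false (f (pt 0 x.2)))) * vs true x.1 x.2
    - (x.1^-1 * (sx true (f (pt x.1 x.2)) - sx true (f (pt 0 x.2)))) * vs false x.1 x.2)).
    by apply/funext => x; rewrite /dy' /dx; ring.
  rewrite E (_ : wedge _ _ = 2^-1 *
    (sx false (m W q) * (sx true (m U q) + sx true (m U q))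
    - sx true (m W q) * (sx false (m U q) + sx false (m U q)))).
    apply: cvgM; first exact: cvg_cst.
    by apply: cvgB; (apply: cvgM; [exact: quotient|
      apply: cvgD; [exact: vel_cvg | exact: vel0_cvg]]).
  by rewrite /wedge /sx; field.
- by apply: filterS near_d_cvg; move=> t [].
Qed.

Let dy_cvg : (fun x : R * R => x.1^-1 * dy x.1 x.2) @ F2 --> cy (m W q).
Proof.
have -> : cy (m W q) = lft (m W q) (f q) 0 2 - 2^-1 *
    (sx false (f q) * sx true (m W q) - sx true (f q) * sx false (m W q)).
  by rewrite -/(cy (lft (m W q) (f q))) /lft /wedge /sx !coordE; ring.
have E : (fun x : R * R => x.1^-1 * dy x.1 x.2) = (fun x : R * R =>
    x.1^-1 * (f (pt x.1 x.2) 0 2 - f (pt 0 x.2) 0 2) - 2^-1 *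
  (sx false (f (pt 0 x.2)) * (x.1^-1 * (sx true (f (pt x.1 x.2)) - sx true (f (pt 0 x.2))))
  - sx true (f (pt 0 x.2)) *
    (x.1^-1 * (sx false (f (pt x.1 x.2)) - sx false (f (pt 0 x.2)))))).
  by apply/funext => x; rewrite /dy /wedge /cy /sx; ring.
rewrite E; apply: cvgB.
  under eq_fun do rewrite pt0.
  exact: (@quotient_cvg _ _ openOm _ _ ld q W a b 2 Oq).
apply: cvgM; first exact: cvg_cst.
by apply: cvgB; (apply: cvgM; [exact: pos0_cvg|exact: quotient]).
Qed.

(** Same argument as for [variation_y]; the cubic correction disappears in the limit
because it is quadratic in the difference of the two curves. *)
Lemma variation_z i : is_derive (0 : R) (1 : R)
  (fun t => sz i (m (Ad a b t W) (q ** (t *: U)))) (- (cy (m W q) * sx i (m U q))).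
Proof.
apply: (derive_lim (phi := dz i) (psi := dz' i)).
- by apply: filterS near_derive; move=> x [].
- have E : (fun x : R * R => x.1^-1 * dz' i x.1 x.2) = (fun x : R * R =>
    - (2^-1 * (x.1^-1 * dy x.1 x.2) * vs i x.1 x.2)
    + 12^-1 * (x.1^-1 * (sx i (f (pt x.1 x.2)) - sx i (f (pt 0 x.2)))) *
      (dx false x.1 x.2 * vd true x.1 x.2 - dx true x.1 x.2 * vd false x.1 x.2)).
    by apply/funext => x; rewrite /dz' /dx; ring.
  have xc j : dx j x.1 x.2 @[x --> F2] --> sx j (f q) - sx j (f q).
    by apply: cvgB; [exact: pos_cvg|exact: pos0_cvg].
  have vc j : vd j x.1 x.2 @[x --> F2] --> sx j (m U q) - sx j (m U q).
    by apply: cvgB; [exact: vel_cvg|exact: vel0_cvg].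
  rewrite E (_ : - (cy _ * _) = - (2^-1 * cy (m W q) * (sx i (m U q) + sx i (m U q)))
    + 12^-1 * sx i (m W q) * ((sx false (f q) - sx false (f q)) *
      (sx true (m U q) - sx true (m U q)) - (sx true (f q) - sx true (f q)) *
      (sx false (m U q) - sx false (m U q)))); last by field.
  apply: cvgD; first apply: cvgN; first apply: cvgM.
  + by apply: cvgM; [exact: cvg_cst|exact: dy_cvg].
  + by apply: cvgD; [exact: vel_cvg|exact: vel0_cvg].
  + apply: cvgM; first by apply: cvgM; [exact: cvg_cst|exact: quotient].
    by apply: cvgB; (apply: cvgM; [exact: xc|exact: vc]).
- by apply: filterS near_d_cvg; move=> t [_ /(_ i)].
Qed.

End AtPoint.
End ContactEquations.

(** * Structure equations *)

Section StructureEquations.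
Context {R : realType}.
Local Notation V := 'rV[R]_5.

Lemma cvg_dnbhsW (T : topologicalType) (g : R -> T) (l : T) :
  g t @[t --> (0 : R)] --> l -> g t @[t --> (0 : R)^'] --> l.
Proof. by move=> H A /H; exact: nbhs_dnbhs. Qed.

Lemma derive_unique (g h : R -> R) (t l l' : R) :
  is_derive t (1 : R) g l -> is_derive t (1 : R) h l' ->
  (\forall x \near t, g x = h x) -> l = l'.
Proof.
move=> dg dh gh; have [_ <-] := near_eq_is_derive gh dg.
by have [_ <-] := dh.
Qed.

Definition Yv : V := vec5 0 0 1 0 0.
Definition Zv (a b : R) : V := vec5 0 0 0 a b.

Lemma bracket_hv a b c d : bracket (hv a b) (hv c d) = (a * d - b * c) *: Yv.
Proof.
by apply: vec5_inj; rewrite /bracket /hv /Yv /wedge !coordE; ring.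
Qed.

Lemma bracket_Yv a b : bracket (hv a b) Yv = Zv a b.
Proof.
by apply: vec5_inj; rewrite /bracket /hv /Yv /Zv /wedge !coordE; ring.
Qed.

Lemma bracket_Zv a b c d : bracket (hv a b) (Zv c d) = 0.
Proof.
by apply: vec5_inj; rewrite /bracket /hv /Zv /wedge !coordE; ring.
Qed.

Context (Om : set V) (openOm : open Om) (f : V -> V) (m : V -> V -> V).
Context (cd : contact_differential Om f m).
Let ld := cd_left cd.

Lemma line_coord_cvg (c : V -> R) q W U : Om q ->
  (forall p, c @ p --> c p) ->
  c (m W (q ** (t *: U))) @[t --> (0 : R)^'] --> c (m W q).
Proof.
move=> Oq cc.
have := cvg_comp _ _ (@line_cvg R q U) (@ld_cvg _ _ _ _ ld q W Oq).
by move=> H; exact: (cvg_dnbhsW (cvg_comp _ _ H (cc _))).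
Qed.

(** At t = 0 the operator Ad differs from the identity by - t [hv a b, W] to first
order, which accounts for the bracket term; the continuity of [m] handles the rest. *)
Lemma Ad_derive (c : V -> R) q W a b l : Om q ->
  (forall p, c @ p --> c p) ->
  (forall p r, c (p + r) = c p + c r) -> (forall k p, c (k *: p) = k * c p) ->
  is_derive (0 : R) (1 : R)
    (fun t => c (m (Ad a b t W) (q ** (t *: hv a b)))) l ->
  is_derive (0 : R) (1 : R) (fun t => c (m W (q ** (t *: hv a b))))
    (c (m (bracket (hv a b) W) q) + l).
Proof.
move=> Oq cc cD cZ H.
set W' := bracket (hv a b) W; set W'' := bracket (hv a b) W'.
pose g t := c (m W' (q ** (t *: hv a b))) - t / 2 * c (m W'' (q ** (t *: hv a b))).
have gl : g t @[t --> (0 : R)^'] --> c (m W' q).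
  have -> : c (m W' q) = c (m W' q) - 0 / 2 * c (m W'' q) by rewrite !mul0r subr0.
  have h1 := @line_coord_cvg c q W' (hv a b) Oq cc.
  have h2 := @line_coord_cvg c q W'' (hv a b) Oq cc.
  apply: cvgB; first exact: h1.
  apply: cvgM; last exact: h2.
  apply: cvgM; last exact: cvg_cst.
  by apply: cvg_dnbhsW; exact: cvg_id.
have dg := derive_mulid gl.
apply: (@near_eq_is_derive _ _ _ (fun t : R => t * g t +
  c (m (Ad a b t W) (q ** (t *: hv a b))))).
  apply: filterS (near_line openOm (hv a b) Oq) => t Ot.
  by rewrite (m_Ad ld)// !cD -!scaleNr !cZ /g -/W' -/W''; field.
Qed.

(** The y-component of d(f^*theta) = f^*(d theta), evaluated on a horizontal vector
and W. *)
Lemma structure_y q W a b : Om q ->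
  is_derive (0 : R) (1 : R) (fun t => cy (m W (q ** (t *: hv a b))))
    (cy (m (bracket (hv a b) W) q) + wedge (m W q) (m (hv a b) q)).
Proof.
move=> Oq; apply: Ad_derive => //; last exact: (@variation_y _ _ openOm _ _ cd q W Oq a b).
- by move=> p; have /cvg_coord[] := (@cvg_id _ (nbhs p)).
- by move=> p r; rewrite coordE.
- by move=> k p; rewrite coordE.
Qed.

(** The z-components of d(f^*theta) = f^*(d theta), evaluated on a horizontal vector
and W. *)
Lemma structure_z i q W a b : Om q ->
  is_derive (0 : R) (1 : R) (fun t => sz i (m W (q ** (t *: hv a b))))
    (sz i (m (bracket (hv a b) W) q) - cy (m W q) * sx i (m (hv a b) q)).
Proof.
move=> Oq; apply: Ad_derive => //; last exact: (@variation_z _ _ openOm _ _ cd q W Oq a b i).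
- by move=> p; have /cvg_coord[] := (@cvg_id _ (nbhs p)); case: i.
- by move=> p r; case: i; rewrite /= coordE.
- by move=> k p; case: i; rewrite /= coordE.
Qed.

(** [J] is the determinant of the action of f on horizontal planes, by
[wedge_horizontal]; [zeta] is minus three times the horizontal derivative of [J],
by [J_zeta]. *)
Definition J q := cy (m Yv q).
Definition zeta a b q := cy (m (Zv a b) q).

Lemma horizontal_coords q a b : Om q ->
  [/\ cy (m (hv a b) q) = 0, cz1 (m (hv a b) q) = 0 & cz2 (m (hv a b) q) = 0].
Proof.
by move=> Oq; rewrite (cd_horizontal cd)// /hv !coordE.
Qed.

Lemma derive_near0 (g : R -> R) l : is_derive (0 : R) (1 : R) g l ->
  (\forall t \near (0 : R), g t = 0) -> l = 0.
Proof. by move=> dg g0; apply: (derive_unique dg (is_derive_cst 0 _ _) g0). Qed.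

(** [structure_y] for a horizontal W: the left-hand side is the derivative of 0. *)
Lemma wedge_horizontal q a b c d : Om q ->
  wedge (m (hv a b) q) (m (hv c d) q) = (a * d - b * c) * J q.
Proof.
move=> Oq; have := derive_near0 (structure_y (hv c d) a b Oq).
rewrite bracket_hv (ldZ ld)// coordE -/(J q).
have h : \forall t \near (0 : R), cy (m (hv c d) (q ** (t *: hv a b))) = 0.
  by apply: filterS (near_line openOm (hv a b) Oq) => t /(horizontal_coords c d)[].
by move=> /(_ h) /eqP; rewrite addr_eq0 => /eqP ->; rewrite /wedge; ring.
Qed.

Lemma J_neq0 q : Om q -> J q != 0.
Proof.
move=> Oq; have := cd_nondegenerate cd Oq.
by rewrite wedge_horizontal// mulr1 mulr0 subr0 mul1r.
Qed.

(** [structure_z] for a horizontal W: f preserves the span of the horizontal vectors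
and their bracket. *)
Lemma sz_Yv i q : Om q -> sz i (m Yv q) = 0.
Proof.
move=> Oq; have := derive_near0 (structure_z i (hv 0 1) 1 0 Oq).
rewrite bracket_hv mulr1 mul0r subr0 scale1r => H.
have [h0 _ _] := horizontal_coords 0 1 Oq.
rewrite -H ?h0 ?mul0r ?subr0//.
apply: filterS (near_line openOm (hv 1 0) Oq) => t /(horizontal_coords 0 1)[].
by case: i {H}.
Qed.

(** [structure_z] for W = Y, whose left-hand side vanishes by [sz_Yv]. *)
Lemma sz_Zv i a b q : Om q -> sz i (m (Zv a b) q) = J q * sx i (m (hv a b) q).
Proof.
move=> Oq; apply/eqP; rewrite -subr_eq0; apply/eqP.
have := derive_near0 (structure_z i Yv a b Oq); rewrite bracket_Yv; apply.
by apply: filterS (near_line openOm (hv a b) Oq) => t; exact: sz_Yv.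
Qed.

(** The bracket term of the structure equation disappears because W is central. *)
Lemma zeta_derive a b c d q : Om q ->
  is_derive (0 : R) (1 : R) (fun t => zeta c d (q ** (t *: hv a b)))
    (wedge (m (Zv c d) q) (m (hv a b) q)).
Proof.
move=> Oq; have := structure_y (Zv c d) a b Oq.
have m0 : m 0 q = 0 by have := ldZ ld 0 0 Oq; rewrite !scale0r.
rewrite bracket_Zv m0 coord0 add0r. move=> H; exact: H.
Qed.

(** By [sz_Zv] the function is the z-component of the image of a central vector, and
the structure equation has no bracket term. *)
Lemma Jvel_derive i a b c d q : Om q ->
  is_derive (0 : R) (1 : R)
    (fun t => J (q ** (t *: hv a b)) * sx i (m (hv c d) (q ** (t *: hv a b))))
    (- (zeta c d q * sx i (m (hv a b) q))).
Proof.
move=> Oq; have := structure_z i (Zv c d) a b Oq.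
have m0 : m 0 q = 0 by have := ldZ ld 0 0 Oq; rewrite !scale0r.
rewrite bracket_Zv m0 (_ : sz i 0 = 0) ?add0r; last by case: i; rewrite /= coord0.
apply: near_eq_is_derive.
by apply: filterS (near_line openOm (hv a b) Oq) => t; exact: sz_Zv.
Qed.

Let J_derive0 a b q : Om q ->
  is_derive (0 : R) (1 : R) (fun t => J (q ** (t *: hv a b)))
    (zeta a b q + wedge (m Yv q) (m (hv a b) q)).
Proof. by move=> Oq; have := structure_y Yv a b Oq; rewrite bracket_Yv. Qed.

Lemma linear_hv q a b : Om q ->
  m (hv a b) q = a *: m (hv 1 0) q + b *: m (hv 0 1) q.
Proof.
move=> Oq; rewrite -!(ldZ ld)// -(ldD ld)//; congr (m _ _).
by apply: vec5_inj; rewrite /hv !coordE; ring.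
Qed.

Lemma zeta_lin q a b : Om q -> zeta a b q = a * zeta 1 0 q + b * zeta 0 1 q.
Proof.
move=> Oq; rewrite /zeta -!(coordZ _ (m _ _)) -coordD -!(ldZ ld)// -(ldD ld)//.
congr (cy (m _ _)).
by apply: vec5_inj; rewrite /Zv !coordE; ring.
Qed.

(** J^3 is the determinant of the matrix with entries J X_i f_j.  Differentiating it
once directly and once by [Jvel_derive] determines the derivative of J. *)
Lemma J_zeta a b q : Om q ->
  zeta a b q + wedge (m Yv q) (m (hv a b) q) = - (zeta a b q / 3).
Proof.
move=> Oq; set D := LHS.
have JD : is_derive (0 : R) (1 : R) (fun t => J (q ** (t *: hv a b))) D.
  exact: J_derive0.
have d11 := Jvel_derive false a b 1 0 Oq.
have d12 := Jvel_derive true a b 1 0 Oq.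
have d21 := Jvel_derive false a b 0 1 Oq.
have d22 := Jvel_derive true a b 0 1 Oq.
set g11 := (X in is_derive _ _ X _) in d11.
set g12 := (X in is_derive _ _ X _) in d12.
set g21 := (X in is_derive _ _ X _) in d21.
set g22 := (X in is_derive _ _ X _) in d22.
set g := (X in is_derive _ _ X _) in JD.
have H : \forall t \near (0 : R), g11 t * g22 t - g12 t * g21 t = g t * g t * g t.
  apply: filterS (near_line openOm (hv a b) Oq) => t Ot.
  have := wedge_horizontal 1 0 0 1 Ot; rewrite /wedge => E.
  transitivity (J (q ** (t *: hv a b)) ^+ 2 * ((1 * 1 - 0 * 0) * J (q ** (t *: hv a b)))).
    by rewrite -E /g11 /g22 /g12 /g21 /=; ring.
  by rewrite /g; ring.
have d1 := is_deriveB (is_deriveM d11 d22) (is_deriveM d12 d21).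
have d3 := is_deriveM (is_deriveM JD JD) JD.
have := derive_unique d1 d3 H.
have -> : (g * g) 0 = J q * J q.
  by rewrite -[LHS]/(g 0 * g 0) /g scale0r mul0.
rewrite /g /g11 /g12 /g21 /g22 !(scale0r, mul0) /GRing.scale /=.
rewrite (linear_hv a b)// !coordE (zeta_lin a b)//.
have := wedge_horizontal 1 0 0 1 Oq; rewrite /wedge mulr1 mulr0 subr0 mul1r => E.
have J0 := J_neq0 Oq => F.
apply: (@mulfI _ (3 * J q ^+ 2)).
  by rewrite mulf_neq0 ?expf_neq0// pnatr_eq0.
transitivity (- J q * (a * zeta 1 0 q + b * zeta 0 1 q) * J q); last by field.
rewrite -[X in _ = _ * X]E.
transitivity (J q * J q * D + J q * (J q * D + J q * D)); first by ring.
by rewrite -F; ring.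
Qed.

End StructureEquations.

(** * Horizontal lines are mapped into horizontal lines *)

Section Lines.
Context {R : realType}.
Local Notation V := 'rV[R]_5.
Context (Om : set V) (openOm : open Om) (f : V -> V) (m : V -> V -> V).
Context (cd : contact_differential Om f m).
Let ld := cd_left cd.
Local Notation J := (J m).
Local Notation zeta := (zeta m).

Lemma J_derive a b q : Om q ->
  is_derive (0 : R) (1 : R) (fun t => J (q ** (t *: hv a b))) (- (zeta a b q / 3)).
Proof.
move=> Oq; rewrite -(J_zeta openOm cd)//.
by have := structure_y openOm cd (Yv) a b Oq; rewrite bracket_Yv.
Qed.

Lemma wedge_Yv a b q : Om q ->
  wedge (m Yv q) (m (hv a b) q) = - (4 / 3 * zeta a b q).
Proof.
move=> /(J_zeta openOm cd a b)/(canRL (addKr _)) ->; by field.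
Qed.

(** Divide [Jvel_derive] by J and use the derivative of J just found. *)
Lemma vel_derive i a b c d q : Om q ->
  is_derive (0 : R) (1 : R) (fun t => sx i (m (hv c d) (q ** (t *: hv a b))))
    ((zeta a b q / 3 * sx i (m (hv c d) q) - zeta c d q * sx i (m (hv a b) q)) / J q).
Proof.
move=> Oq; have J0 := J_neq0 openOm cd Oq.
have dJ := J_derive a b Oq; have dg := Jvel_derive openOm cd i a b c d Oq.
set g := (X in is_derive _ _ X _) in dg; set j := (X in is_derive _ _ X _) in dJ.
have j0 : j 0 = J q by rewrite /j scale0r mul0.
have jn0 : j 0 != 0 by rewrite j0.
have dV := is_deriveV jn0 dJ.
apply: (@near_eq_is_derive _ _ _ (fun t : R => g t * (j t)^-1)).
  apply: filterS (near_line openOm (hv a b) Oq) => t Ot.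
  by rewrite /g /j mulrAC mulfV ?mul1r// (J_neq0 openOm cd).
apply: is_derive_eq; rewrite j0 /g !(scale0r, mul0) /GRing.scale /=.
by field.
Qed.

Section OneLine.
Context (q : V) (a b : R).
Local Notation pt t := (q ** (t *: hv a b)).

Lemma line_J t : Om (pt t) ->
  is_derive t (1 : R) (fun t => J (pt t)) (- (zeta a b (pt t) / 3)).
Proof. by move=> Ot; apply: derive_line; exact: J_derive. Qed.

Lemma line_zeta t : Om (pt t) ->
  is_derive t (1 : R) (fun t => zeta a b (pt t))
    (wedge (m (Zv a b) (pt t)) (m (hv a b) (pt t))).
Proof.
by move=> Ot; apply: derive_line; exact: (zeta_derive openOm cd).
Qed.

(** With equal directions in [vel_derive], the velocity is an eigenvector: its
derivative is parallel to it. *)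
Lemma line_vel i t : Om (pt t) ->
  is_derive t (1 : R) (fun t => sx i (m (hv a b) (pt t)))
    (- (2 / 3 * zeta a b (pt t) * sx i (m (hv a b) (pt t)) / J (pt t))).
Proof.
move=> Ot; apply: (derive_line (g := fun p => sx i (m (hv a b) p))).
apply: is_derive_eq; first exact: vel_derive.
by field; exact: (J_neq0 openOm cd).
Qed.

Lemma line_sx i t : Om (pt t) ->
  is_derive t (1 : R) (fun t => sx i (f (pt t))) (sx i (m (hv a b) (pt t))).
Proof. by move=> /(horizontal_derive cd)[]. Qed.

Context (segment : forall t : R, 0 <= t <= 1 -> Om (pt t)).

(** By [line_vel] and [line_J] the velocity and J^2 satisfy the same linear equation
along the line, so their quotient is constant. *)
Lemma line_direction i (t : R) : 0 <= t <= 1 ->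
  sx i (m (hv a b) (pt t)) = (J (pt t) / J q) ^+ 2 * sx i (m (hv a b) q).
Proof.
move=> t01.
have q0 : pt 0 = q by rewrite scale0r mul0.
pose g t := sx i (m (hv a b) (pt t)) / (J (pt t) * J (pt t)).
suff dg (s : R) : 0 <= s <= 1 -> is_derive s (1 : R) g 0.
  have := derive0_cst01 dg t01; rewrite /g q0 => H.
  have Jt := J_neq0 openOm cd (segment t01).
  have J0 : J q != 0.
    by rewrite -{1}q0; apply: (J_neq0 openOm cd); apply: segment; rewrite lexx ler01.
  by rewrite -[LHS](mulfVK (_ : J (pt t) * J (pt t) != 0)) ?mulf_neq0// H; field.
move=> s01.
have Js := J_neq0 openOm cd (segment s01).
have dv := line_vel i (segment s01); have dJ := line_J (segment s01).
have dV := is_deriveV (f := fun t => J (pt t) * J (pt t)) (mulf_neq0 Js Js)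
  (is_deriveM dJ dJ).
by apply: is_derive_eq; rewrite /GRing.scale /=; field.
Qed.

Lemma line_collinear (t : R) : 0 <= t <= 1 ->
  wedge (f (pt t) - f q) (m (hv a b) q) = 0.
Proof.
move=> t01; have q0 : pt 0 = q by rewrite scale0r mul0.
pose g t := wedge (f (pt t) - f q) (m (hv a b) q).
suff dg (s : R) : 0 <= s <= 1 -> is_derive s (1 : R) g 0.
  by have := derive0_cst01 dg t01; rewrite /g q0 subrr => ->;
    rewrite /wedge !coord0; ring.
move=> s01; rewrite /g /wedge; under eq_fun do rewrite !coordE.
have := line_sx true (segment s01); have := line_sx false (segment s01).
have e1 := line_direction true s01; have e2 := line_direction false s01.
rewrite e1 e2 /sx => ? ?.
by apply: is_derive_eq; rewrite /GRing.scale /=; ring.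
Qed.

End OneLine.

Lemma near_segments q W a b : Om q ->
  \forall x \near (nbhs (0 : R), nbhs (0 : R)),
    forall r, 0 <= r <= 1 -> Om (q ** (x.1 *: W) ** ((r * x.2) *: hv a b)).
Proof.
move=> Oq; have [[A B] /= [A0 B0] AB] := near_plaque openOm W (hv a b) Oq.
move/nbhs0_lt: B0 => [d d0 dB].
exists (A, [set t | `|t| < d]); first by split=> //; apply/nbhs0_lt; exists d.
move=> [s t] /= [As td] r /andP[r0 r1]; apply: (AB (s, r * t)); split=> //=.
apply: dB; rewrite normrM (ger0_norm r0); apply: le_lt_trans td.
by rewrite ler_piMl.
Qed.

(** [line_collinear] on each line of the plaque, rescaled to have length t. *)
Lemma plaque_collinear q W a b : Om q ->
  \forall x \near (nbhs (0 : R), nbhs (0 : R)),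
    wedge (f (q ** (x.1 *: W) ** (x.2 *: hv a b)) - f (q ** (x.1 *: W)))
      (m (hv a b) (q ** (x.1 *: W))) = 0.
Proof.
move=> Oq; apply: filterS (near_segments W a b Oq); case=> s t /= H.
have [->|t0] := eqVneq t 0.
  by rewrite scale0r mul0 subrr /wedge !coord0; ring.
have E r : r *: hv (t * a) (t * b) = (r * t) *: hv a b.
  by apply: vec5_inj; rewrite /hv !coordE; ring.
have O1 : Om (q ** (s *: W)).
  by have := H 0; rewrite mul0r scale0r mul0; apply; rewrite lexx ler01.
have := @line_collinear (q ** (s *: W)) (t * a) (t * b) _ 1.
rewrite E mul1r => H1.
have {H1} : wedge (f (q ** (s *: W) ** (t *: hv a b)) - f (q ** (s *: W)))
    (m (hv (t * a) (t * b)) (q ** (s *: W))) = 0.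
  by apply: H1; rewrite ?ler01 ?lexx// => r r01; rewrite E; exact: H.
rewrite (_ : hv (t * a) (t * b) = t *: hv a b); last first.
  by apply: vec5_inj; rewrite /hv !coordE; ring.
rewrite (ldZ ld)// /wedge !coordE => H1.
by apply: (mulfI t0); rewrite mulr0 -[RHS]H1; ring.
Qed.

(** Differentiate at s = 0 the collinearity of the images of the lines of the plaque.
Both factors of the wedge are differentiable in s: the position because f is C^1,
the velocity by [vel_derive]. *)
Lemma bending q a b c d : Om q -> \forall t \near (0 : R),
  wedge (m (Ad a b t (hv c d)) (q ** (t *: hv a b)) - m (hv c d) q) (m (hv a b) q)
  = zeta a b q / J q * wedge (f (q ** (t *: hv a b)) - f q) (m (hv c d) q).
Proof.
move=> Oq; set W := hv c d.
have [[A B] /= [A0 B0] AB] := filterI (near_plaque openOm W (hv a b) Oq)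
  (plaque_collinear W a b Oq).
apply: filterS B0 => t Bt.
have Ot : Om (q ** (t *: hv a b)).
  have [|] := AB (0, t); first by split=> //=; exact: nbhs_singleton A0.
  by rewrite /= scale0r mul0.
have [d1 d2 _ _ _] := left_derive ld (Ad a b t W) Ot.
have [e1 e2 _ _ _] := left_derive ld W Oq.
have v1 := vel_derive false c d a b Oq; have v2 := vel_derive true c d a b Oq.
have D (g : V -> R) l : is_derive (0 : R) (1 : R)
    (fun h => g (f (q ** (t *: hv a b) ** (h *: Ad a b t W)))) l ->
    is_derive (0 : R) (1 : R) (fun s => g (f (q ** (s *: W) ** (t *: hv a b)))) l.
  move=> H; apply: (derive_conj (g := fun q => g (f q))).
  by rewrite scale0r mul0.
have {}d1 := D cx1 _ d1; have {}d2 := D cx2 _ d2.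
rewrite /lft !coordE in d1 d2 e1 e2.
rewrite /sx in v1 v2.
pose g s := (cx1 (f (q ** (s *: W) ** (t *: hv a b))) - cx1 (f (q ** (s *: W))))
  * cx2 (m (hv a b) (q ** (s *: W))) -
  (cx2 (f (q ** (s *: W) ** (t *: hv a b))) - cx2 (f (q ** (s *: W))))
  * cx1 (m (hv a b) (q ** (s *: W))).
have g0 : \forall s \near (0 : R), g s = 0.
  apply: filterS A0 => s As.
  have [|_] := AB (s, t); first by [].
  by rewrite /wedge /= !coordE.
have dg : is_derive (0 : R) (1 : R) g
    (wedge (m (Ad a b t W) (q ** (t *: hv a b)) - m W q) (m (hv a b) q)
    - zeta a b q / J q * wedge (f (q ** (t *: hv a b)) - f q) (m W q)
    + zeta c d q / 3 / J q * wedge (f (q ** (t *: hv a b)) - f q) (m (hv a b) q)).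
  apply: is_derive_eq; rewrite !(scale0r, mul0) /GRing.scale /= /wedge !coordE -/W.
  by field; exact: (J_neq0 openOm cd).
have := derive_near0 dg g0.
have := nbhs_singleton g0; rewrite /g !(scale0r, mul0) => H.
rewrite (_ : wedge (f _ - _) (m (hv a b) q) = 0) ?mulr0 ?addr0.
  by move/eqP; rewrite subr_eq0 => /eqP.
by rewrite /wedge !coordE.
Qed.

End Lines.

(** * The Schwarzian equation along a line *)

Section Schwarzian.
Context {R : realType}.
Local Notation V := 'rV[R]_5.
Context (Om : set V) (openOm : open Om) (f : V -> V) (m : V -> V -> V).
Context (cd : contact_differential Om f m).
Let ld := cd_left cd.
Local Notation J := (J m).
Local Notation zeta := (zeta m).

(** [line_direction] on short lines on both sides of q. *)
Lemma near_direction q a b : Om q -> \forall t \near (0 : R), forall i,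
  J q ^+ 2 * sx i (m (hv a b) (q ** (t *: hv a b))) =
  J (q ** (t *: hv a b)) ^+ 2 * sx i (m (hv a b) q).
Proof.
move=> Oq; have J0 := J_neq0 openOm cd Oq.
have [[A B] /= [A0 B0] AB] := near_segments openOm 0 a b Oq.
apply: filterS B0 => t Bt i.
have H r : 0 <= r <= 1 -> Om (q ** ((r * t) *: hv a b)).
  move=> r01; have := AB (0, t); rewrite /= scale0r mul0 => /(_ _ r r01); apply.
  by split=> //=; exact: nbhs_singleton A0.
have [->|t0] := eqVneq t 0; first by rewrite scale0r mul0.
have E r : r *: hv (t * a) (t * b) = (r * t) *: hv a b.
  by apply: vec5_inj; rewrite /hv !coordE; ring.
have := @line_direction _ _ openOm _ _ cd q (t * a) (t * b) _ i 1.
rewrite E mul1r => H1.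
have {}H1 := H1 (fun r r01 => eq_ind_r (fun U => Om (q ** U)) (H r r01) (E r)).
move: H1; rewrite ler01 lexx => /(_ isT).
rewrite (_ : hv (t * a) (t * b) = t *: hv a b); last first.
  by apply: vec5_inj; rewrite /hv !coordE; ring.
have Ot : Om (q ** (t *: hv a b)) by have := H 1; rewrite mul1r; apply; rewrite ler01 lexx.
have sxZ p : sx i (t *: p) = t * sx i p by case: i; rewrite /= coordZ.
rewrite !(ldZ ld)// !sxZ => H1.
apply: (mulfI t0); rewrite mulrCA H1.
by field.
Qed.

(** Since zeta = - 3 v(J), this is v(v(J)) = 2 v(J)^2 / J.  By [bending], with the
transverse direction W orthogonal to the line, a combination [phi] of functions
differentiable along the line equals - t^2 Z(t) / 2.  The left side has a second-order
expansion at t = 0 whose t^2 coefficient contains Z(0) with another factor; comparing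
the two determines Z(0). *)
Lemma schwarzian q a b : Om q ->
  wedge (m (Zv a b) q) (m (hv a b) q) = - (2 / 3 * zeta a b q ^+ 2 / J q).
Proof.
move=> Oq; have J0 := J_neq0 openOm cd Oq.
set d := a * a + b * b.
have [d0|d0] := eqVneq d 0.
  move/eqP: d0; rewrite /d -!expr2 paddr_eq0 ?sqr_ge0// !sqrf_eq0.
  move=> /andP[/eqP a0 /eqP b0].
  have m0 : m 0 q = 0 by have := ldZ ld 0 0 Oq; rewrite !scale0r.
  have -> : zeta a b q = 0.
    rewrite /zeta (_ : Zv a b = 0) ?m0 ?coord0//.
    by rewrite a0 b0; apply: vec5_inj; rewrite /Zv !coordE.
  rewrite (_ : hv a b = 0) ?m0; first by rewrite /wedge !coord0; ring.
  by rewrite a0 b0; apply: vec5_inj; rewrite /hv !coordE.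
(* Along the line Z is the derivative of zeta, and T has derivative d J^2 / J(q). *)
pose W := hv (- b) a : V.
pose pt t := q ** (t *: hv a b).
pose j t := J (pt t); pose z t := zeta a b (pt t).
pose Z t := wedge (m (Zv a b) (pt t)) (m (hv a b) (pt t)).
pose T t := wedge (f (pt t) - f q) (m W q).
have pt0 : pt 0 = q by rewrite /pt scale0r mul0.
have j0 : j 0 = J q by rewrite /j pt0.
have z0 : z 0 = zeta a b q by rewrite /z pt0.
have T0 : T 0 = 0 by rewrite /T pt0 subrr /wedge !coord0; ring.
rewrite -z0 -j0 [LHS](_ : _ = Z 0); last by rewrite /Z pt0.
rewrite -j0 in J0.
have nO : \forall t \near (0 : R), Om (pt t) := near_line openOm (hv a b) Oq.
have dj : \forall t \near (0 : R), is_derive t (1 : R) j (- (z t / 3)).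
  by apply: filterS nO => t; exact: (line_J openOm cd).
have dz : \forall t \near (0 : R), is_derive t (1 : R) z (Z t).
  by apply: filterS nO => t; exact: (line_zeta openOm cd).
have dT : \forall t \near (0 : R), is_derive t (1 : R) T (d * j t ^+ 2 / j 0).
  apply: filterS2 nO (near_direction a b Oq) => t Ot dir.
  have x1 := line_sx cd true Ot; have x0 := line_sx cd false Ot.
  have -> : d * j t ^+ 2 / j 0 = wedge (m (hv a b) (pt t)) (m W q).
    apply: (mulfI (expf_neq0 2 J0)).
    rewrite -[RHS](_ : (j 0 ^+ 2 * sx false (m (hv a b) (pt t))) * cx2 (m W q) -
      (j 0 ^+ 2 * sx true (m (hv a b) (pt t))) * cx1 (m W q) = _); last first.
      by rewrite /wedge /=; ring.
    rewrite j0 !dir -/(pt t) -/(j t).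
    transitivity (j t ^+ 2 * wedge (m (hv a b) q) (m W q)); last first.
      by rewrite /wedge /=; ring.
    by rewrite (wedge_horizontal openOm cd)// -j0 /d; field.
  rewrite /T /wedge; under eq_fun do rewrite !coordE.
  rewrite /sx in x0 x1.
  by apply: is_derive_eq; rewrite /GRing.scale /= /pt; ring.
have eqn : \forall t \near (0 : R), - j t + 4 / 3 * (t * z t) + j t ^+ 2 / j 0
    - z 0 / j 0 ^+ 4 * (j 0 * T t / d) * j t ^+ 2 = - (t ^+ 2 * Z t / 2).
  near=> t.
  have Ot : Om (pt t) by near: t.
  have dir : forall i, J q ^+ 2 * sx i (m (hv a b) (pt t)) =
    J (pt t) ^+ 2 * sx i (m (hv a b) q) by near: t; exact: (near_direction a b Oq).
  have : wedge (m (Ad a b t W) (pt t) - m W q) (m (hv a b) q)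
     = zeta a b q / J q * wedge (f (pt t) - f q) (m W q) by near: t; exact: (bending openOm cd).
  rewrite (m_Ad ld)// bracket_hv (_ : a * a - b * - b = d); last by rewrite /d; ring.
  have -> : bracket (hv a b) (d *: Yv) = d *: Zv a b.
    by apply: vec5_inj; rewrite /bracket /hv /Yv /Zv /wedge !coordE; ring.
  rewrite !(ldZ ld)// -/(T t) -z0 -j0 => E.
  have e1 : wedge (m W (pt t)) (m (hv a b) (pt t)) = - d * j t.
    by rewrite (wedge_horizontal openOm cd)// /d /j; ring.
  have e2 : wedge (m Yv (pt t)) (m (hv a b) (pt t)) = - (4 / 3 * z t).
    exact: (wedge_Yv openOm cd).
  have e3 : wedge (m W q) (m (hv a b) q) = - d * j 0.
    by rewrite (wedge_horizontal openOm cd)// j0 /d; ring.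
  have : j t ^+ 2 * (z 0 / j 0 * T t) = j 0 ^+ 2 * (- d * j t + t * d * (4 / 3 * z t)
      + t ^+ 2 / 2 * d * Z t) + d * j 0 * j t ^+ 2.
    rewrite -E.
    transitivity (j 0 ^+ 2 * (wedge (m W (pt t)) (m (hv a b) (pt t))
      - t * d * wedge (m Yv (pt t)) (m (hv a b) (pt t)) + t ^+ 2 / 2 * d * Z t)
      - j t ^+ 2 * wedge (m W q) (m (hv a b) q)); last first.
      by rewrite e1 e2 e3; ring.
    move: (dir true) (dir false); rewrite -j0 -/(j t) /sx => d1 d2.
    rewrite /Z /wedge !coordE.
    pose A i := sx i (m W (pt t)) - t * (d * sx i (m Yv (pt t)))
      + t ^+ 2 / 2 * (d * sx i (m (Zv a b) (pt t))).
    transitivity (A false * (j t ^+ 2 * cx2 (m (hv a b) q))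
      - A true * (j t ^+ 2 * cx1 (m (hv a b) q))
      - j t ^+ 2 * (cx1 (m W q) * cx2 (m (hv a b) q)
      - cx2 (m W q) * cx1 (m (hv a b) q))); first by rewrite /A /=; ring.
    by rewrite -d1 -d2 /A /=; ring.
  move=> H.
  have -> : z 0 / j 0 ^+ 4 * (j 0 * T t / d) * j t ^+ 2 =
    (j t ^+ 2 * (z 0 / j 0 * T t)) / (j 0 ^+ 2 * d) by field; rewrite d0 J0.
  by rewrite H; field; rewrite d0 J0.
(* [psi] is the derivative of [phi]; its term with the merely continuous [Z] is kept
   apart from [psi0], which is differentiable at 0. *)
pose phi t := - j t + 4 / 3 * (t * z t) + j t ^+ 2 / j 0
    - z 0 / j 0 ^+ 4 * (j 0 * T t / d) * j t ^+ 2.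
pose psi0 t := 5 / 3 * z t - 2 / 3 * j t * z t / j 0
   - z 0 / j 0 ^+ 4 * (j t ^+ 4 - 2 / 3 * (j 0 * T t / d) * j t * z t).
pose psi t := psi0 t + 4 / 3 * (t * Z t).
have phi0 : phi 0 = 0 by rewrite /phi T0; field; rewrite d0 J0.
have dphi : \forall t \near (0 : R), is_derive t (1 : R) phi (psi t).
  near=> t.
  have dj' : is_derive t (1 : R) j (- (z t / 3)) by near: t.
  have dz' : is_derive t (1 : R) z (Z t) by near: t.
  have dT' : is_derive t (1 : R) T (d * j t ^+ 2 / j 0) by near: t.
  rewrite /phi; apply: is_derive_eq; rewrite /psi /psi0 /GRing.scale /=.
  by field; rewrite d0 J0.
have dj0 := nbhs_singleton dj; have dz0 := nbhs_singleton dz.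
have dT0 := nbhs_singleton dT.
have dpsi0 : is_derive (0 : R) (1 : R) psi0 (Z 0 + 20 / 9 * z 0 ^+ 2 / j 0).
  rewrite /psi0; apply: is_derive_eq; rewrite /GRing.scale /= T0.
  by field; rewrite d0 J0.
have psi00 : psi0 0 = 0 by rewrite /psi0 T0; field; rewrite d0 J0.
have Z_cvg : Z t @[t --> (0 : R)^'] --> Z 0.
  have /cvg_coord[c1 c2 _ _ _] := cvg_comp _ _ (@line_cvg R q (hv a b))
    (@ld_cvg _ _ _ _ ld q (Zv a b) Oq).
  have /cvg_coord[c1' c2' _ _ _] := cvg_comp _ _ (@line_cvg R q (hv a b))
    (@ld_cvg _ _ _ _ ld q (hv a b) Oq).
  rewrite {2}/Z pt0; apply: cvg_dnbhsW.
  by apply: cvgB; apply: cvgM.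
have psi_cvg : psi t / t @[t --> (0 : R)^'] -->
    (Z 0 + 20 / 9 * z 0 ^+ 2 / j 0) + 4 / 3 * Z 0.
  have E : \forall t \near (0 : R)^', t^-1 * (psi0 (0 + t) - psi0 0) + 4 / 3 * Z t
      = psi t / t.
    rewrite near_withinE; apply: nearW => t t0.
    by rewrite add0r psi00 /psi; field.
  apply: (cvg_trans (near_eq_cvg E)); apply: cvgD.
    exact/deriveP_cvg.
  by apply: cvgM; [exact: cvg_cst|exact: Z_cvg].
have phi_cvg : phi t / t ^+ 2 @[t --> (0 : R)^'] -->
    2^-1 * ((Z 0 + 20 / 9 * z 0 ^+ 2 / j 0) + 4 / 3 * Z 0).
  apply: (peano2 phi0 dphi); last by rewrite /psi psi00; ring.
  by rewrite mulrA mulfV ?pnatr_eq0// mul1r.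
have phi_cvg' : phi t / t ^+ 2 @[t --> (0 : R)^'] --> - (2^-1 * Z 0).
  have E : \forall t \near (0 : R)^', - (2^-1 * Z t) = phi t / t ^+ 2.
    rewrite near_withinE; apply: filterS eqn => t eqt t0.
    by rewrite /phi eqt; field.
  apply: (cvg_trans (near_eq_cvg E)).
  by apply: cvgN; apply: cvgM; [exact: cvg_cst|exact: Z_cvg].
pose X := 20 / 9 * z 0 ^+ 2 / j 0.
have H : 2^-1 * ((Z 0 + X) + 4 / 3 * Z 0) = - (2^-1 * Z 0).
  exact: (cvg_unique _ phi_cvg phi_cvg').
have {}H : 10 / 3 * Z 0 = - X by move: (Z 0) X H => z1 x H; lra.
apply: (@mulfI _ (10 / 3)); first by rewrite mulf_neq0// ?invr_neq0// pnatr_eq0.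
by rewrite H /X; field.
Unshelve. all: by end_near. Qed.

End Schwarzian.

(** * Projective reparametrisation of lines *)

Section AffineAlongLines.
Context {R : realType}.
Local Notation V := 'rV[R]_5.

(** Affinity on each line separately would allow a slope that is merely homogeneous in
the direction; here it is linear. *)
Definition horizontally_affine (D : set V) (F : V -> R) : Prop :=
  exists G1 G2 : V -> R, forall q a b,
    (forall t : R, 0 <= t <= 1 -> D (q ** (t *: hv a b))) ->
    F (q ** hv a b) = F q + (a * G1 q + b * G2 q).

Context (Om : set V) (openOm : open Om) (f : V -> V) (m : V -> V -> V).
Context (cd : contact_differential Om f m).
Let ld := cd_left cd.
Local Notation J := (J m).
Local Notation zeta := (zeta m).

(** Together with 1, x1, x2, y and [quartic] below, these two polynomials span the
functions on the group that are affine along all horizontal lines. *)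
Definition sh (i : bool) (p : V) : R := 6 * sz i p + sx i p * cy p.

Section Segment.
Context (q : V) (a b : R).
Local Notation pt t := (q ** (t *: hv a b)).
Context (segment : forall t : R, 0 <= t <= 1 -> Om (pt t)).

Let pt0 : pt 0 = q.
Proof. by rewrite scale0r mul0. Qed.

Let J0 : J q != 0.
Proof.
by rewrite -pt0; apply: (J_neq0 openOm cd); apply: segment; rewrite lexx ler01.
Qed.

Let Jn0 (t : R) : 0 <= t <= 1 -> J (pt t) != 0.
Proof. by move=> /segment; exact: (J_neq0 openOm cd). Qed.

(** The derivative of 1/J along the line is zeta / (3 J^2), and [schwarzian] says that
this is constant. *)
Lemma line_Jinv (t : R) : 0 <= t <= 1 ->
  (J (pt t))^-1 = (J q)^-1 + t * (zeta a b q / (3 * J q ^+ 2)) /\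
  zeta a b (pt t) / J (pt t) ^+ 2 = zeta a b q / J q ^+ 2.
Proof.
move=> t01.
pose j t := J (pt t); pose z t := zeta a b (pt t).
have dV (s : R) : 0 <= s <= 1 -> is_derive s (1 : R) (fun t => (j t)^-1)
    (z s / (3 * j s ^+ 2)).
  move=> s01; have Js := Jn0 s01.
  have dj : is_derive s (1 : R) j (- (z s / 3)) := line_J openOm cd (segment s01).
  apply: (is_derive_eq (is_deriveV (f := j) Js dj)).
  by rewrite /GRing.scale /=; field.
have dz (s : R) : 0 <= s <= 1 -> is_derive s (1 : R) z (- (2 / 3 * z s ^+ 2 / j s)).
  move=> s01; have Os := segment s01.
  by rewrite -(schwarzian openOm cd a b Os); exact: (line_zeta openOm cd).
pose g t := z t * ((j t)^-1 * (j t)^-1).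
have dg (s : R) : 0 <= s <= 1 -> is_derive s (1 : R) g 0.
  move=> s01; have dVs := dV s s01; have dzs := dz s s01; have Js : j s != 0 := Jn0 s01.
  by apply: is_derive_eq; rewrite /GRing.scale /=; field.
have gE (s : R) : 0 <= s <= 1 -> z s / j s ^+ 2 = zeta a b q / J q ^+ 2.
  move=> s01; have -> : z s / j s ^+ 2 = g s by rewrite /g -invfM -expr2.
  by rewrite (derive0_cst01 dg s01) /g /z /j pt0 -invfM -expr2.
split; last exact: gE.
pose h t := (j t)^-1 - t * (zeta a b q / (3 * J q ^+ 2)).
have dh (s : R) : 0 <= s <= 1 -> is_derive s (1 : R) h 0.
  move=> s01; have dVs := dV s s01; have Js : j s != 0 := Jn0 s01.
  apply: is_derive_eq; rewrite /GRing.scale /=.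
  have E := gE s s01.
  have -> : z s / (3 * j s ^+ 2) = (z s / j s ^+ 2) / 3 by field.
  by rewrite E; field.
have := derive0_cst01 dh t01; rewrite /h /j mul0r subr0 pt0 => <-.
by rewrite subrK.
Qed.

(* Quotient of the affine functions t and J(q) / J(pt t): a projective parameter. *)
Let rho t := t * J (pt t) / J q.

Let rho0 : rho 0 = 0.
Proof. by rewrite /rho !mul0r. Qed.

Let drho (t : R) : 0 <= t <= 1 -> is_derive t (1 : R) rho ((J (pt t) / J q) ^+ 2).
Proof.
move=> t01; have Jt := Jn0 t01; have [E1 E2] := line_Jinv t01.
pose j t := J (pt t).
have dj : is_derive t (1 : R) j (- (zeta a b (pt t) / 3)).
  exact: (line_J openOm cd (segment t01)).
have zE : zeta a b (pt t) = 3 * j t ^+ 2 * (zeta a b q / (3 * J q ^+ 2)).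
  transitivity (zeta a b (pt t) / J (pt t) ^+ 2 * j t ^+ 2); first by rewrite /j; field.
  by rewrite E2; field.
rewrite zE in dj; rewrite -/(j t) in E1 Jt *.
have {}E1 : t * (zeta a b q / (3 * J q ^+ 2)) = (j t)^-1 - (J q)^-1.
  by rewrite E1; ring.
have -> : (j t / J q) ^+ 2 =
    (j t - j t ^+ 2 * (t * (zeta a b q / (3 * J q ^+ 2)))) / J q.
  by rewrite E1; field; rewrite J0 Jt.
rewrite (_ : rho = fun t => t * j t / J q)//.
by apply: is_derive_eq; rewrite /GRing.scale /=; field; rewrite J0.
Qed.

(** The velocity is J^2 up to constants and 1/J is affine, so the position is an affine
function of [rho].  Along a horizontal line of the image y and 6 z + x y are affine in
the parameter, and the same parameter serves for them. *)
Lemma line_image (t : R) : 0 <= t <= 1 ->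
  let w := m (hv a b) q in
  [/\ forall i, sx i (f (pt t)) = sx i (f q) + rho t * sx i w,
      cy (f (pt t)) = cy (f q) + rho t * (2^-1 * wedge (f q) w) &
      forall i, sh i (f (pt t)) = sh i (f q)
        + rho t * (sx i (f q) * wedge (f q) w - 2 * cy (f q) * sx i w)].
Proof.
move=> t01 w.
have cst (g : R -> R) : (forall s : R, 0 <= s <= 1 -> is_derive s (1 : R) g 0) ->
  forall s : R, 0 <= s <= 1 -> g s = g 0 := fun dg s => derive0_cst01 dg (t := s).
have X i (s : R) : 0 <= s <= 1 -> sx i (f (pt s)) = sx i (f q) + rho s * sx i w.
  pose g s := sx i (f (pt s)) - rho s * sx i w => s01.
  have dg (r : R) : 0 <= r <= 1 -> is_derive r (1 : R) g 0.
    move=> r01; have := line_sx cd i (segment r01).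
    rewrite (line_direction openOm cd segment i r01) => dx.
    have dr := drho r01.
    by apply: is_derive_eq; rewrite /GRing.scale /= -/w; ring.
  have := cst _ dg s s01; rewrite /g rho0 mul0r subr0 pt0 => <-.
  by rewrite subrK.
have Y (s : R) : 0 <= s <= 1 ->
    cy (f (pt s)) = cy (f q) + rho s * (2^-1 * wedge (f q) w).
  pose g s := cy (f (pt s)) - rho s * (2^-1 * wedge (f q) w) => s01.
  have dg (r : R) : 0 <= r <= 1 -> is_derive r (1 : R) g 0.
    move=> r01; have [_ dy _] := horizontal_derive cd (segment r01).
    have dr := drho r01.
    apply: is_derive_eq; rewrite /GRing.scale /=.
    rewrite /wedge -!/(sx true _) -!/(sx false _) !X//.
    by rewrite !(line_direction openOm cd segment _ r01) -/w /sx; ring.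
  have := cst _ dg s s01; rewrite /g rho0 mul0r subr0 pt0 => <-.
  by rewrite subrK.
split=> [i||i]; [exact: X | exact: Y |].
pose c := sx i (f q) * wedge (f q) w - 2 * cy (f q) * sx i w.
pose g s := sh i (f (pt s)) - rho s * c.
have dg (r : R) : 0 <= r <= 1 -> is_derive r (1 : R) g 0.
  move=> r01; have [dx dy dz] := horizontal_derive cd (segment r01).
  have dr := drho r01; have {}dx := dx i; have {}dz := dz i.
  rewrite /g /sh.
  apply: is_derive_eq; rewrite /GRing.scale /=.
  rewrite Y// /c /wedge -!/(sx true _) -!/(sx false _) !X//.
  by rewrite !(line_direction openOm cd segment _ r01) -/w; case: i {c g dx dz};
    rewrite /sx; field.
have := cst _ dg t t01; rewrite /g rho0 mul0r subr0 pt0 => <-.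
by rewrite subrK.
Qed.

End Segment.

Lemma affine_Jinv : horizontally_affine Om (fun q => (J q)^-1).
Proof.
exists (fun q => zeta 1 0 q / (3 * J q ^+ 2)), (fun q => zeta 0 1 q / (3 * J q ^+ 2)).
move=> q a b seg.
have Oq : Om q by rewrite -[q]mul0 -(scale0r (hv a b)); apply: seg; rewrite lexx ler01.
have J0 := J_neq0 openOm cd Oq.
have [|+ _] := @line_Jinv q a b seg 1; first by rewrite lexx ler01.
rewrite scale1r mul1r => ->; rewrite (zeta_lin cd a b Oq).
by field.
Qed.

(** 1/J is affine and rho J^-1 is linear along the line, hence so is any combination of
them. *)
Lemma affine_quotient (psi : V -> R) (g1 g2 : V -> R) :
  (forall q a b, (forall t : R, 0 <= t <= 1 -> Om (q ** (t *: hv a b))) ->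
    psi (f (q ** hv a b)) = psi (f q)
      + J (q ** hv a b) / J q * (a * g1 q + b * g2 q)) ->
  horizontally_affine Om (fun q => psi (f q) / J q).
Proof.
move=> H; have [G1 [G2 HG]] := affine_Jinv.
exists (fun q => psi (f q) * G1 q + g1 q / J q),
  (fun q => psi (f q) * G2 q + g2 q / J q) => q a b seg.
have Oq : Om q by rewrite -[q]mul0 -(scale0r (hv a b)); apply: seg; rewrite lexx ler01.
have Oq' : Om (q ** hv a b).
  by rewrite -(scale1r (hv a b)); apply: seg; rewrite lexx ler01.
have J0 := J_neq0 openOm cd Oq; have J0' := J_neq0 openOm cd Oq'.
rewrite H// mulrDl mulrAC -[_ / _ / _]mulrA [(J q)^-1 / _]mulrC mulrA mulfV// mul1r.
by rewrite HG//; ring.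
Qed.

Lemma affine_image :
  [/\ forall i, horizontally_affine Om (fun q => sx i (f q) / J q),
      horizontally_affine Om (fun q => cy (f q) / J q) &
      forall i, horizontally_affine Om (fun q => sh i (f q) / J q)].
Proof.
have image q a b (seg : forall t : R, 0 <= t <= 1 -> Om (q ** (t *: hv a b))) :=
  @line_image q a b seg 1.
have lin i q a b : Om q ->
    sx i (m (hv a b) q) = a * sx i (m (hv 1 0) q) + b * sx i (m (hv 0 1) q).
  by move=> Oq; rewrite (linear_hv cd)//; case: i; rewrite /= !coordE.
have in0 q a b : (forall t : R, 0 <= t <= 1 -> Om (q ** (t *: hv a b))) -> Om q.
  by move=> seg; rewrite -[q]mul0 -(scale0r (hv a b)); apply: seg; rewrite lexx ler01.
have le1 : (0 : R) <= (1 : R) <= 1 by rewrite lexx ler01.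
split=> [i||i].
- apply: (affine_quotient (psi := sx i) (g1 := fun q => sx i (m (hv 1 0) q))
    (g2 := fun q => sx i (m (hv 0 1) q))) => q a b seg.
  have [+ _ _] := image q a b seg le1; rewrite scale1r mul1r => ->.
  by rewrite lin//; exact: in0 seg.
- apply: (affine_quotient (psi := cy)
    (g1 := fun q => 2^-1 * wedge (f q) (m (hv 1 0) q))
    (g2 := fun q => 2^-1 * wedge (f q) (m (hv 0 1) q))) => q a b seg.
  have [_ + _] := image q a b seg le1; rewrite scale1r mul1r => ->.
  have := lin true q a b (in0 _ _ _ seg); have := lin false q a b (in0 _ _ _ seg).
  by rewrite /wedge /sx => -> ->; ring.
- pose g c d q := sx i (f q) * wedge (f q) (m (hv c d) q)
    - 2 * cy (f q) * sx i (m (hv c d) q).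
  apply: (affine_quotient (psi := sh i) (g1 := g 1 0) (g2 := g 0 1)) => q a b seg.
  have [_ _ +] := image q a b seg le1; rewrite scale1r mul1r => ->.
  have := lin true q a b (in0 _ _ _ seg); have := lin false q a b (in0 _ _ _ seg).
  by rewrite /g /wedge; case: i {g}; rewrite /sx => -> ->; ring.
Qed.

End AffineAlongLines.

(** * Functions affine along horizontal lines *)

Section AffineFunctions.
Context {R : realType}.
Local Notation V := 'rV[R]_5.

(** It vanishes at the points reached from 0 by two horizontal segments and, where y does
not vanish, only there ([quartic_decomposition]). *)
Definition quartic (p : V) : R := 2 * cy p ^+ 2 - 3 * (cz1 p * cx2 p - cz2 p * cx1 p).
(** [mu1] and [mu2] are, up to a quarter turn, the slope of [quartic] along horizontal
lines. *)
Definition mu1 (p : V) : R := 3 * cz1 p - 2^-1 * cy p * cx1 p.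
Definition mu2 (p : V) : R := 3 * cz2 p - 2^-1 * cy p * cx2 p.

Lemma quartic_line (q : V) (a b : R) :
  quartic (q ** hv a b) = quartic q - (mu1 q * b - mu2 q * a).
Proof. by rewrite /quartic /mu1 /mu2 /cartan_mul /hv !coordE; field. Qed.

Lemma sh_line i (q : V) (a b : R) : sh i (q ** hv a b) =
  sh i q + (sx i q * wedge q (hv a b) - 2 * cy q * sx i (hv a b)).
Proof.
by case: i; rewrite /sh /sx /sz /wedge /cartan_mul /hv !coordE; field.
Qed.

Lemma cy_line (q : V) (a b : R) : cy (q ** hv a b) = cy q + 2^-1 * wedge q (hv a b).
Proof. by rewrite /wedge /cartan_mul /hv !coordE; field. Qed.

Definition first_vertex (r : V) i : R := sh i r / (2 * cy r).

(** On the hypersurface the vertex [first_vertex r] can be read off the endpoint, because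
6 z + y x is 2 y times the first vertex of a two-segment path issued from 0. *)
Lemma quartic_decomposition r : quartic r = 0 -> cy r != 0 ->
  r = hv (first_vertex r false) (first_vertex r true) **
      hv (cx1 r - first_vertex r false) (cx2 r - first_vertex r true).
Proof.
move=> P0 y0.
have E : cz1 r * cx2 r - cz2 r * cx1 r = 2 / 3 * cy r ^+ 2.
  by move: P0; rewrite /quartic; set X := _ - _ * cx1 r => P0; lra.
have w : first_vertex r false * (cx2 r - first_vertex r true)
    - first_vertex r true * (cx1 r - first_vertex r false) = 2 * cy r.
  transitivity (3 * (cz1 r * cx2 r - cz2 r * cx1 r) / cy r).
    by rewrite /first_vertex /sh /sx /sz; field.
  by rewrite E; field.
apply: vec5_inj; rewrite /cartan_mul /hv !coordE ?w.
- by ring.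
- by ring.
- by field.
- by rewrite /first_vertex /sh /sx /sz; field.
- by rewrite /first_vertex /sh /sx /sz; field.
Qed.

Definition coords_le (C : R) (q : V) : Prop :=
  [/\ `|cx1 q| <= C, `|cx2 q| <= C, `|cy q| <= C, `|cz1 q| <= C & `|cz2 q| <= C].

(** A function affine in each variable is determined by its values at the corners, up
to a bilinear term that one diagonal excludes. *)
Lemma biaffine (c : R -> R -> R) :
  (forall y, 1 <= y <= 2 -> exists A B, forall x, 1 <= x <= 2 -> c x y = A + B * x) ->
  (forall x, 1 <= x <= 2 -> exists A B, forall y, 1 <= y <= 2 -> c x y = A + B * y) ->
  c 1 2 + c 2 1 = 2 * c (3 / 2) (3 / 2) ->
  exists A B C, forall x y, 1 <= x <= 2 -> 1 <= y <= 2 -> c x y = A + B * x + C * y.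
Proof.
move=> Hx Hy Hd.
have i1 : 1 <= (1 : R) <= 2 by lra.
have i2 : 1 <= (2 : R) <= 2 by lra.
have im : 1 <= (3 / 2 : R) <= 2 by lra.
have [A1 [B1 H1]] := Hy 1 i1; have [A2 [B2 H2]] := Hy 2 i2.
have key x y : 1 <= x <= 2 -> 1 <= y <= 2 ->
    c x y = (2 - x) * (A1 + B1 * y) + (x - 1) * (A2 + B2 * y).
  move=> ix iy; have [A [B H]] := Hx y iy.
  rewrite H//.
  have e1 : A + B * 1 = A1 + B1 * y by rewrite -H// H1.
  have e2 : A + B * 2 = A2 + B2 * y by rewrite -H// H2.
  by rewrite -e1 -e2; ring.
have B12 : B1 = B2.
  have := Hd; rewrite !key//; lra.
exists (2 * A1 - A2), (A2 - A1), B1 => x y ix iy.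
by rewrite key// B12; ring.
Qed.

(** It suffices to know F along segments that start in a fixed bounded part of the group;
20 exceeds every coordinate of a starting point or direction that occurs below. *)
Definition affine20 (F G1 G2 : V -> R) : Prop := forall q a b,
  coords_le 20 q -> `|a| <= 20 -> `|b| <= 20 ->
  F (q ** hv a b) = F q + (a * G1 q + b * G2 q).

Section FromOrigin.
Context (F G1 G2 : V -> R) (aff : affine20 F G1 G2).
Context (F0 : F 0 = 0) (G10 : G1 0 = 0) (G20 : G2 0 = 0).

Let i12 (x : R) : 1 <= x <= 2 -> `|x| <= 20.
Proof. by rewrite ler_norml => ?; apply/andP; lra. Qed.

Let norm0 : `|0 : R| <= 20.
Proof. by rewrite normr0; lra. Qed.

Let coords_le0 : coords_le 20 (0 : V).
Proof. by split; rewrite coord0. Qed.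

Let coords_le_hv a b : `|a| <= 20 -> `|b| <= 20 -> coords_le 20 (hv a b).
Proof. by split; rewrite /hv coordE. Qed.

Let F_hv a b : `|a| <= 20 -> `|b| <= 20 -> F (hv a b) = 0.
Proof.
move=> a20 b20; have := aff coords_le0 a20 b20.
rewrite F0 G10 G20 !mulr0 !addr0.
by congr (F _ = _); apply: vec5_inj; rewrite /cartan_mul /hv !coordE; ring.
Qed.

(* The slope at a point of the horizontal plane through 0 is orthogonal to the position,
   since F vanishes on the plane; [c] is the remaining coefficient. *)
Let c a b := G2 (hv a b) / a.

Let G_hv a b : 1 <= a <= 2 -> 1 <= b <= 2 ->
  G1 (hv a b) = - (b * c a b) /\ G2 (hv a b) = a * c a b.
Proof.
move=> ia ib; have a0 : a != 0 by apply/eqP => a0; lra.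
have := @aff (hv a b) (- a) (- b) (coords_le_hv (i12 ia) (i12 ib)).
rewrite !normrN => /(_ (i12 ia) (i12 ib)).
rewrite F_hv ?i12//.
have -> : hv a b ** hv (- a) (- b) = 0 :> V.
  by apply: vec5_inj; rewrite /cartan_mul /hv !coordE; ring.
rewrite F0 add0r => H; split; last by rewrite /c mulrC divfK.
have {}H : a * G1 (hv a b) = - (b * G2 (hv a b)) by lra.
by apply: (mulfI a0); rewrite H /c; field.
Qed.

Let F_hvhv a b d e : 1 <= a <= 2 -> 1 <= b <= 2 -> `|d| <= 20 -> `|e| <= 20 ->
  F (hv a b ** hv d e) = c a b * (a * e - b * d).
Proof.
move=> ia ib d20 e20; rewrite (aff (coords_le_hv (i12 ia) (i12 ib)) d20 e20).
rewrite (F_hv (i12 ia) (i12 ib)).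
by have [-> ->] := G_hv ia ib; ring.
Qed.

(* The point (0, 0, 3, z1, z2) is joined by a segment to the endpoint of a two-segment
   path with first vertex (a, b), and this holds along a whole line of such vertices. *)
Let c_line (z1 z2 a b : R) : 1 <= a <= 2 -> 1 <= b <= 2 ->
  `|z1| <= 6 -> `|z2| <= 6 -> z1 * b - z2 * a = - 6 ->
  6 * c a b = F (vec5 0 0 3 z1 z2)
    + ((z1 - a) * G1 (vec5 0 0 3 z1 z2) + (z2 - b) * G2 (vec5 0 0 3 z1 z2)).
Proof.
rewrite !ler_norml => ia ib /andP[z1l z1u] /andP[z2l z2u] E.
have h (x : R) : - 20 <= x <= 20 -> `|x| <= 20 by rewrite ler_norml.
have bq : coords_le 20 (vec5 0 0 3 z1 z2) by split; rewrite coordE; apply: h; lra.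
have da : `|z1 - a| <= 20 by apply: h; lra.
have db : `|z2 - b| <= 20 by apply: h; lra.
rewrite -(aff bq da db).
have w : a * (z2 - b - b) - b * (z1 - a - a) = 6 by lra.
have -> : vec5 0 0 3 z1 z2 ** hv (z1 - a) (z2 - b) =
    hv a b ** hv (z1 - a - a) (z2 - b - b).
  by apply: vec5_inj; rewrite /cartan_mul /hv !coordE ?w; field.
rewrite F_hvhv//; [|by apply: h; lra|by apply: h; lra].
by rewrite w mulrC.
Qed.

Let c_affine : exists A B C, forall x y, 1 <= x <= 2 -> 1 <= y <= 2 ->
  c x y = A + B * x + C * y.
Proof.
apply: biaffine.
(* The central points (0, 0, 3, z1, z2) with z1 b - z2 a = - 6 see the whole line of
   vertices (a, b) that this equation describes: a horizontal or vertical line, or the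
   diagonal of the square for z = (- 2, 2). *)
- move=> y iy; have y0 : y != 0 by apply/eqP => y0; lra.
  pose q : V := vec5 0 0 3 (- 6 / y) 0.
  exists ((F q + (- 6 / y * G1 q - y * G2 q)) / 6), (- G1 q / 6) => x ix.
  apply: (@mulfI _ 6); first by rewrite pnatr_eq0.
  rewrite (@c_line (- 6 / y) 0 x y)// -/q; first by field.
  + by rewrite ler_norml; apply/andP; split;
      rewrite ?ler_pdivrMr ?ler_pdivlMr; lra.
  + by rewrite normr0.
  + by field.
- move=> x ix; have x0 : x != 0 by apply/eqP => x0; lra.
  pose q : V := vec5 0 0 3 0 (6 / x).
  exists ((F q + (6 / x * G2 q - x * G1 q)) / 6), (- G2 q / 6) => y iy.
  apply: (@mulfI _ 6); first by rewrite pnatr_eq0.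
  rewrite (@c_line 0 (6 / x) x y)// -/q; first by field.
  + by rewrite normr0.
  + by rewrite ler_norml; apply/andP; split;
      rewrite ?ler_pdivrMr ?ler_pdivlMr; lra.
  + by field.
- have i1 : 1 <= (1 : R) <= 2 by lra.
  have i2 : 1 <= (2 : R) <= 2 by lra.
  have im : 1 <= (3 / 2 : R) <= 2 by lra.
  have n2 : `|2 : R| <= 6 by rewrite ger0_norm; lra.
  have n2' : `|- 2 : R| <= 6 by rewrite normrN.
  have h1 := @c_line (- 2) 2 1 2; have h2 := @c_line (- 2) 2 2 1.
  have h3 := @c_line (- 2) 2 (3 / 2) (3 / 2).
  have e1 : - 2 * 2 - 2 * 1 = - 6 :> R by ring.
  have e2 : - 2 * 1 - 2 * 2 = - 6 :> R by ring.
  have e3 : - 2 * (3 / 2) - 2 * (3 / 2) = - 6 :> R by field.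
  have {}h1 := h1 i1 i2 n2' n2 e1; have {}h2 := h2 i2 i1 n2' n2 e2.
  have {}h3 := h3 im im n2' n2 e3.
  lra.
Qed.

Definition lin3 (A B C : R) (r : V) : R :=
  2 * A * cy r + B * sh false r + C * sh true r.

(** With c affine, c times 2 y is a combination of y and of 6 z + x y, because the first
vertex times 2 y is 6 z + x y. *)
Lemma affine_on_quartic : exists A B C, forall a b d e,
  1 <= a <= 2 -> 1 <= b <= 2 -> `|d| <= 20 -> `|e| <= 20 ->
  F (hv a b ** hv d e) = lin3 A B C (hv a b ** hv d e).
Proof.
have [A [B [C H]]] := c_affine; exists A, B, C => a b d e ia ib d20 e20.
rewrite F_hvhv// H// /lin3 /sh /sx /sz /cartan_mul /hv !coordE.
by field.
Qed.

End FromOrigin.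

(** The first coordinate for which the segment from q along [hv _ k] ends on the
quartic; it solves an affine equation by [quartic_line]. *)
Definition foot1 (k : R) (q : V) : R := (mu1 q * k - quartic q) / mu2 q.
Definition foot (k : R) (q : V) : V := q ** hv (foot1 k q) k.

(** An open condition, which gathers the nonvanishing and the bounds that the
argument uses at q. *)
Definition projects (k : R) (q : V) : Prop :=
  [/\ mu2 q != 0, quartic q != 0, cy (foot k q) != 0 &
   [/\ coords_le 20 q, `|foot1 k q| <= 20,
      1 <= first_vertex (foot k q) false <= 2, 1 <= first_vertex (foot k q) true <= 2 &
      `|cx1 (foot k q) - first_vertex (foot k q) false| <= 20 /\
      `|cx2 (foot k q) - first_vertex (foot k q) true| <= 20]].

Lemma foot_decomposition k q : projects k q ->
  foot k q = hv (first_vertex (foot k q) false) (first_vertex (foot k q) true) **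
    hv (cx1 (foot k q) - first_vertex (foot k q) false)
       (cx2 (foot k q) - first_vertex (foot k q) true).
Proof.
case=> m0 P0 y0 _; apply: quartic_decomposition => //.
by rewrite /foot quartic_line /foot1; field.
Qed.

(** A point off the quartic.  For 0 < k < 1 its foot has first vertex (1 + k, 2 - k),
inside the square where the slopes on the horizontal plane are known. *)
Definition q0 : V := vec5 0 0 3 (- 2) 2.

Lemma ge1_neq0 (x b : R) : 1 <= x <= b -> x != 0.
Proof. by case/andP=> x1 _; apply: lt0r_neq0; apply: lt_le_trans x1. Qed.

Lemma cvg_itv (T : Type) (F : set_system T) {FF : Filter F} (g : T -> R) (l a b : R) :
  g x @[x --> F] --> l -> a < l < b -> \forall x \near F, a <= g x <= b.
Proof.
move=> gl /andP[al lb]; near=> x; apply/andP; split; apply: ltW; near: x.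
  exact: (cvgr_gt _ gl).
exact: (cvgr_lt _ gl).
Unshelve. all: by end_near. Qed.

(** At q0 all the functions involved are continuous and the conditions hold strictly. *)
Lemma filter_projects (k : R) (F : set_system V) (FF : Filter F) :
  0 < k < 1 -> q @[q --> F] --> q0 -> \forall q \near F, projects k q.
Proof.
move=> k01 Fq0; have [c1 c2 c3 c4 c5] := cvg_coord Fq0.
have [e1 e2 e3 e4 e5] : [/\ cx1 q0 = 0, cx2 q0 = 0, cy q0 = 3, cz1 q0 = - 2 & cz2 q0 = 2].
  by rewrite /q0 !coordE.
rewrite e1 in c1; rewrite e2 in c2; rewrite e3 in c3; rewrite e4 in c4.
rewrite e5 in c5.
have mu1c : mu1 q @[q --> F] --> (- 6 : R).
  have -> : - 6 = 3 * - 2 - 2^-1 * 3 * 0 :> R by ring.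
  by rewrite /mu1; cvg_poly.
have mu2c : mu2 q @[q --> F] --> (6 : R).
  have -> : 6 = 3 * 2 - 2^-1 * 3 * 0 :> R by ring.
  by rewrite /mu2; cvg_poly.
have Pc : quartic q @[q --> F] --> (18 : R).
  have -> : 18 = 2 * (3 * 3) - 3 * (- 2 * 0 - 2 * 0) :> R by ring.
  by rewrite /quartic; under eq_fun do rewrite expr2; cvg_poly.
have n6 : (6 : R) != 0 by rewrite pnatr_eq0.
have m2V : (mu2 q)^-1 @[q --> F] --> (6^-1 : R) by exact: cvgV mu2c.
have fc : foot1 k q @[q --> F] --> ((- 6 * k - 18) / 6 : R).
  by rewrite /foot1; cvg_poly.
have {}fc : foot1 k q @[q --> F] --> (- 3 - k : R).
  have -> : - 3 - k = (- 6 * k - 18) / 6 :> R by field.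
  exact: fc.
have rc : foot k q @[q --> F] --> q0 ** hv (- 3 - k) k.
  apply: cvg_mulg; first exact: Fq0.
  by apply: cvg_vec5; rewrite /hv !coordE; under eq_fun do rewrite coordE;
    cvg_poly.
have [r1 r2 r3 r4 r5] := cvg_coord rc.
have E1 : cx1 (q0 ** hv (- 3 - k) k) = - 3 - k by rewrite /q0 /cartan_mul /hv !coordE; ring.
have E2 : cx2 (q0 ** hv (- 3 - k) k) = k by rewrite /q0 /cartan_mul /hv !coordE; ring.
have E3 : cy (q0 ** hv (- 3 - k) k) = 3 by rewrite /q0 /cartan_mul /hv !coordE; ring.
have E4 : cz1 (q0 ** hv (- 3 - k) k) = - 2 + 3 / 2 * (3 + k).
  by rewrite /q0 /cartan_mul /hv !coordE; field.
have E5 : cz2 (q0 ** hv (- 3 - k) k) = 2 - 3 / 2 * k.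
  by rewrite /q0 /cartan_mul /hv !coordE; field.
rewrite E1 in r1; rewrite E2 in r2; rewrite E3 in r3; rewrite E4 in r4; rewrite E5 in r5.
have n3 : (2 * 3 : R) != 0 by rewrite mulf_neq0// pnatr_eq0.
have y2 : 2 * cy (foot k q) @[q --> F] --> (2 * 3 : R) by cvg_poly.
have yV : (2 * cy (foot k q))^-1 @[q --> F] --> (2 * 3 : R)^-1.
  exact: cvgV y2.
have v1 : first_vertex (foot k q) false @[q --> F] --> (1 + k : R).
  have -> : 1 + k = (6 * (- 2 + 3 / 2 * (3 + k)) + (- 3 - k) * 3) / (2 * 3) :> R by field.
  by rewrite /first_vertex /sh /sx /sz; cvg_poly.
have v2 : first_vertex (foot k q) true @[q --> F] --> (2 - k : R).
  have -> : 2 - k = (6 * (2 - 3 / 2 * k) + k * 3) / (2 * 3) :> R by field.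
  by rewrite /first_vertex /sh /sx /sz; cvg_poly.
have w1 : cx1 (foot k q) - first_vertex (foot k q) false @[q --> F] --> (- 3 - k - (1 + k) : R).
  exact: cvgB.
have w2 : cx2 (foot k q) - first_vertex (foot k q) true @[q --> F] --> (k - (2 - k) : R).
  exact: cvgB.
have h (x : R) : - 20 <= x <= 20 -> `|x| <= 20 by rewrite ler_norml.
near=> q.
have b1 : - 20 <= cx1 q <= 20 by near: q; apply: cvg_itv c1 _; lra.
have b2 : - 20 <= cx2 q <= 20 by near: q; apply: cvg_itv c2 _; lra.
have b3 : - 20 <= cy q <= 20 by near: q; apply: cvg_itv c3 _; lra.
have b4 : - 20 <= cz1 q <= 20 by near: q; apply: cvg_itv c4 _; lra.
have b5 : - 20 <= cz2 q <= 20 by near: q; apply: cvg_itv c5 _; lra.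
have a1 : 1 <= mu2 q <= 20 by near: q; apply: cvg_itv mu2c _; lra.
have a2 : 1 <= quartic q <= 20 by near: q; apply: cvg_itv Pc _; lra.
have a3 : 1 <= cy (foot k q) <= 20 by near: q; apply: cvg_itv r3 _; lra.
have a4 : - 20 <= foot1 k q <= 20 by near: q; apply: cvg_itv fc _; lra.
have a5 : 1 <= first_vertex (foot k q) false <= 2 by near: q; apply: cvg_itv v1 _; lra.
have a6 : 1 <= first_vertex (foot k q) true <= 2 by near: q; apply: cvg_itv v2 _; lra.
have a7 : - 20 <= cx1 (foot k q) - first_vertex (foot k q) false <= 20.
  by near: q; apply: cvg_itv w1 _; lra.
have a8 : - 20 <= cx2 (foot k q) - first_vertex (foot k q) true <= 20.
  by near: q; apply: cvg_itv w2 _; lra.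
split; [exact: ge1_neq0 a1|exact: ge1_neq0 a2|exact: ge1_neq0 a3|split].
- by split; exact: h.
- exact: h.
- by [].
- by [].
- by split; exact: h.
Unshelve. all: by end_near. Qed.

Lemma near_projects (k : R) : 0 < k < 1 -> \forall q \near q0, projects k q.
Proof. by move=> k01; exact: (@filter_projects k _ (nbhs_filter q0) k01 (@cvg_id _ _)). Qed.

End AffineFunctions.

Section LocalForm.
Context {R : realType}.
Local Notation V := 'rV[R]_5.
Local Notation q0 := (@q0 R).

Lemma lin3_line A B C (q : V) a b :
  lin3 A B C (q ** hv a b) = lin3 A B C q
  + (a * (- (A * cx2 q) - B * (cx1 q * cx2 q + 2 * cy q) - C * cx2 q ^+ 2)
    + b * (A * cx1 q + B * cx1 q ^+ 2 + C * (cx1 q * cx2 q - 2 * cy q))).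
Proof.
by rewrite /lin3 cy_line !sh_line /wedge /sx /hv !coordE; field.
Qed.

(** The difference H of F and a suitable polynomial vanishes on the quartic, in
particular at the feet of q for two values of k.  These two equations determine the
slope of H at q, and the same equations hold for the quartic itself. *)
Lemma ratio_line_from_origin (F G1 G2 : V -> R) : affine20 F G1 G2 ->
  F 0 = 0 -> G1 0 = 0 -> G2 0 = 0 ->
  exists A B C, forall q a b, projects (1 / 5) q -> projects (4 / 5) q ->
    `|a| <= 20 -> `|b| <= 20 ->
    (F (q ** hv a b) - lin3 A B C (q ** hv a b)) * quartic q =
    (F q - lin3 A B C q) * quartic (q ** hv a b).
Proof.
move=> aff F0 G10 G20.
have [A [B [C FL]]] := affine_on_quartic aff F0 G10 G20.
exists A, B, C => q a b pr1 pr2 a20 b20.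
have [m0 P0 _ [bq _ _ _ _]] := pr1.
set g1 := G1 q - (- (A * cx2 q) - B * (cx1 q * cx2 q + 2 * cy q) - C * cx2 q ^+ 2).
set g2 := G2 q - (A * cx1 q + B * cx1 q ^+ 2 + C * (cx1 q * cx2 q - 2 * cy q)).
pose H r := F r - lin3 A B C r.
have step c d : `|c| <= 20 -> `|d| <= 20 -> H (q ** hv c d) = H q + (c * g1 + d * g2).
  by move=> c20 d20; rewrite /H (aff _ _ _ bq c20 d20) lin3_line /g1 /g2; ring.
have foot0 k : `|k| <= 20 -> projects k q ->
    mu2 q * H q + (mu1 q * k - quartic q) * g1 + k * mu2 q * g2 = 0.
  move=> k20 pr; have [_ _ _ [_ f20 c1 c2 [w1 w2]]] := pr.
  have : H (foot k q) = 0.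
    by rewrite /H (foot_decomposition pr) FL// subrr.
  rewrite /foot step// => E.
  transitivity (mu2 q * (H q + (foot1 k q * g1 + k * g2))); last by rewrite E mulr0.
  by rewrite /foot1; field.
have h (x : R) : - 20 <= x <= 20 -> `|x| <= 20 by rewrite ler_norml.
have k1 : `|1 / 5 : R| <= 20 by apply: h; lra.
have k2 : `|4 / 5 : R| <= 20 by apply: h; lra.
have E1 := foot0 (1 / 5) k1 pr1; have E2 := foot0 (4 / 5) k2 pr2.
have D : mu1 q * g1 + mu2 q * g2 = 0.
  transitivity (5 / 3 *
    ((mu2 q * H q + (mu1 q * (4 / 5) - quartic q) * g1 + 4 / 5 * mu2 q * g2)
    - (mu2 q * H q + (mu1 q * (1 / 5) - quartic q) * g1 + 1 / 5 * mu2 q * g2))).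
    by field.
  by rewrite E1 E2 subrr mulr0.
have g1E : quartic q * g1 = mu2 q * H q.
  apply/eqP; rewrite eq_sym -subr_eq0; apply/eqP.
  transitivity (mu2 q * H q + (mu1 q * (1 / 5) - quartic q) * g1 + 1 / 5 * mu2 q * g2
    - 1 / 5 * (mu1 q * g1 + mu2 q * g2)); first by field.
  by rewrite E1 D mulr0 subrr.
have g2E : quartic q * g2 = - (mu1 q * H q).
  apply: (mulfI m0); transitivity (quartic q * (mu1 q * g1 + mu2 q * g2)
    - mu1 q * (quartic q * g1)); first by ring.
  by rewrite D g1E; ring.
rewrite -/(H q) -/(H (q ** hv a b)) step// quartic_line.
transitivity (H q * quartic q + a * (quartic q * g1) + b * (quartic q * g2)).
  by ring.
by rewrite g1E g2E; ring.
Qed.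

(** The general polynomial of degree at most 3 for the dilations that is affine along
horizontal lines. *)
Definition affine6 c0 c1 c2 A B C (q : V) : R :=
  c0 + c1 * cx1 q + c2 * cx2 q + lin3 A B C q.

Lemma ratio_line (F G1 G2 : V -> R) : affine20 F G1 G2 ->
  exists c0 c1 c2 A B C, forall q a b, projects (1 / 5) q -> projects (4 / 5) q ->
    `|a| <= 20 -> `|b| <= 20 ->
    let H r := F r - affine6 c0 c1 c2 A B C r in
    H (q ** hv a b) * quartic q = H q * quartic (q ** hv a b).
Proof.
move=> aff.
pose F' q := F q - (F 0 + G1 0 * cx1 q + G2 0 * cx2 q).
have [||||A [B [C H]]] := @ratio_line_from_origin F'
  (fun q => G1 q - G1 0) (fun q => G2 q - G2 0).
- move=> q a b bq a20 b20; rewrite /F' (aff _ _ _ bq a20 b20).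
  by rewrite /cartan_mul /hv !coordE; ring.
- by rewrite /F' !coord0; ring.
- by rewrite subrr.
- by rewrite subrr.
exists (F 0), (G1 0), (G2 0), A, B, C => q a b pr1 pr2 a20 b20 /=.
have E r : F r - affine6 (F 0) (G1 0) (G2 0) A B C r = F' r - lin3 A B C r.
  by rewrite /affine6 /F'; ring.
by rewrite !E; exact: H.
Qed.

Lemma nbhs_bounded (p : V) (N : set V) : nbhs p N ->
  exists2 e : R, 0 < e & forall g : V, (forall j, `|g 0 j - p 0 j| < e) -> N g.
Proof.
move=> /nbhs_ballP[e /= e0 eN]; exists e => // g H; apply: eN.
split=> // i j; rewrite !ord1 /ball /= distrC; exact: H.
Qed.

Lemma coords_le_dil C r (g : V) : 0 < r <= 1 -> coords_le C g ->
  coords_le (r * C) (dilation r g).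
Proof.
move=> /andP[r0 r1] [b1 b2 b3 b4 b5].
have r0' := ltW r0.
have k n x : `|x| <= C -> `|r ^+ n.+1 * x| <= r * C.
  move=> xC; rewrite normrM normrX (ger0_norm r0').
  apply: ler_pM => //; first by rewrite exprn_ge0.
  by rewrite exprS ler_piMr// exprn_ile1.
split; rewrite /dilation coordE; by [exact: (k 0%N)|exact: (k 1%N)|exact: (k 2%N)].
Qed.

Lemma coords_le_trans (C C' : R) (g : V) : C <= C' -> coords_le C g -> coords_le C' g.
Proof. by move=> CC' [h1 h2 h3 h4 h5]; split; apply: le_trans CC'. Qed.

Lemma coords_leN C (g : V) : coords_le C g -> coords_le C (- g).
Proof. by case=> *; split; rewrite coordN normrN. Qed.

(** Dilations shrink bounded sets to 0, so a dilated copy of the box fits into any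
neighbourhood; the translation puts the image of q0 at p. *)
Lemma dilated_box (p : V) (N : set V) C : nbhs p N -> 20 <= C ->
  exists2 r : R, 0 < r <= 1 &
    forall g : V, coords_le C g -> N (p ** (- dilation r q0) ** dilation r g).
Proof.
move=> Np C20.
have c : (fun x : V * V => p ** x.1 ** x.2) @ (nbhs (0 : V), nbhs (0 : V)) --> p.
  rewrite -[X in _ --> X]mul0 -[X in _ --> X ** _]mul0.
  apply: cvg_mulg; last exact: cvg_snd.
  by apply: cvg_mulg; [exact: cvg_cst|exact: cvg_fst].
have [[A B] /= [A0 B0] AB] := c _ Np.
have [e1 e10 HA] := nbhs_bounded A0; have [e2 e20 HB] := nbhs_bounded B0.
pose e := Num.min e1 e2.
have e0 : 0 < e by rewrite lt_min e10.
have C0 : 0 < C by lra.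
pose r := Num.min 1 (e / (2 * C)).
have r0 : 0 < r by rewrite lt_min ltr01 divr_gt0// mulr_gt0.
have r1 : r <= 1 by rewrite ge_min lexx.
have re : r * C < e.
  have : r <= e / (2 * C) by rewrite ge_min lexx orbT.
  rewrite ler_pdivlMr ?mulr_gt0// => H; lra.
have r01 : 0 < r <= 1 by rewrite r0.
have small g : coords_le (r * C) g -> forall j, `|g 0 j - (0 : V) 0 j| < e.
  move=> [b1 b2 b3 b4 b5].
  by apply: ord5P; rewrite [X in _ - X]mxE subr0; apply: le_lt_trans re.
exists r => // g bg; apply: (AB (- dilation r q0, dilation r g)); split => /=.
  apply: HA => j; apply: lt_le_trans (small _ _ j) _; last by rewrite ge_min lexx.
  apply/coords_leN/coords_le_dil => //.
  have h (x : R) : - C <= x <= C -> `|x| <= C by rewrite ler_norml.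
  by split; rewrite /q0 coordE; apply: h; lra.
apply: HB => j; apply: lt_le_trans (small _ _ j) _; last by rewrite ge_min lexx orbT.
exact: coords_le_dil.
Qed.

Lemma coords_le_segment (g : V) (a b t : R) : coords_le 20 g -> `|a| <= 20 -> `|b| <= 20 ->
  0 <= t <= 1 -> coords_le 3000 (g ** (t *: hv a b)).
Proof.
move=> [b1 b2 b3 b4 b5] a20 b20 /andP[t0 t1].
have T (c : R) : `|c| <= 20 -> `|t * c| <= 20.
  move=> c20; rewrite normrM (ger0_norm t0); apply: le_trans c20.
  by rewrite ler_piMl.
have P (c d X Y : R) : `|c| <= X -> `|d| <= Y -> `|c * d| <= X * Y.
  by move=> cX dY; rewrite normrM; apply: ler_pM.
have S (c d X Y : R) : `|c| <= X -> `|d| <= Y -> `|c + d| <= X + Y.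
  by move=> cX dY; apply: le_trans (ler_normD _ _) _; apply: lerD.
have N (c X : R) : `|c| <= X -> `|- c| <= X by rewrite normrN.
have a' := T _ a20; have b' := T _ b20.
have le1 (c X Y : R) : X <= Y -> `|c| <= X -> `|c| <= Y.
  by move=> XY cX; apply: le_trans XY.
have half (n : nat) : `|(n.+1%:R)^-1 : R| <= (n.+1%:R)^-1 by rewrite ger0_norm ?invr_ge0.
have W : `|cx1 g * (t * b) - cx2 g * (t * a)| <= 20 * 20 + 20 * 20.
  by apply: S; [exact: P|apply/N/P].
split; rewrite /cartan_mul /hv !coordE ?mulr0 ?addr0.
- by apply: (le1 _ _ _ _ (S _ _ _ _ b1 a')); lra.
- by apply: (le1 _ _ _ _ (S _ _ _ _ b2 b')); lra.
- by apply: (le1 _ _ _ _ (S _ _ _ _ b3 (P _ _ _ _ (half 1%N) W))); lra.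
- have D : `|cx1 g - t * a| <= 20 + 20 by apply: S => //; exact: N.
  have Q : `|0 - cy g * (t * a)| <= 0 + 20 * 20.
    by apply: S; [rewrite normr0|apply/N/P].
  have := S _ _ _ _ (S _ _ _ _ b4 (P _ _ _ _ (half 1%N) Q))
    (P _ _ _ _ (P _ _ _ _ (half 11%N) D) W).
  by apply: le1; lra.
- have D : `|cx2 g - t * b| <= 20 + 20 by apply: S => //; exact: N.
  have Q : `|0 - cy g * (t * b)| <= 0 + 20 * 20.
    by apply: S; [rewrite normr0|apply/N/P].
  have := S _ _ _ _ (S _ _ _ _ b5 (P _ _ _ _ (half 1%N) Q))
    (P _ _ _ _ (P _ _ _ _ (half 11%N) D) W).
  by apply: le1; lra.
Qed.

End LocalForm.

Section AffineLocal.
Context {R : realType}.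
Local Notation V := 'rV[R]_5.
Local Notation q0 := (@q0 R).

Lemma dilationK r (g : V) : r != 0 -> dilation r (dilation r^-1 g) = g.
Proof. by move=> r0; apply: vec5_inj; rewrite /dilation !coordE; field. Qed.

Lemma dilation_hv r a b : dilation r (hv a b) = hv (r * a) (r * b) :> V.
Proof. by apply: vec5_inj; rewrite /dilation /hv !coordE; ring. Qed.

Lemma dilation_cvg (T : Type) (F : set_system T) {FF : Filter F} (g : T -> V) r l :
  g @ F --> l -> (fun x => dilation r (g x)) @ F --> dilation r l.
Proof.
move=> /cvg_coord[? ? ? ? ?].
by apply: cvg_vec5; rewrite /dilation ?coordE; under eq_fun do rewrite ?coordE; cvg_poly.
Qed.

Lemma chart_cvg (p : V) r : r != 0 ->
  (fun q => dilation r^-1 (dilation r q0 ** ((- p) ** q))) @ nbhs p --> q0.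
Proof.
move=> r0; have E : dilation r^-1 (dilation r q0 ** ((- p) ** p)) = q0.
  have -> : (- p) ** p = 0 by rewrite -{2}[p]mul0 mulVK.
  by rewrite mul0 -{2}[r]invrK dilationK// invr_neq0.
rewrite -[X in _ --> X]E; apply: dilation_cvg.
apply: cvg_mulg; first exact: cvg_cst.
by apply: cvg_mulg; [exact: cvg_cst|exact: cvg_id].
Qed.

Lemma chartK (p q : V) r : r != 0 ->
  q = p ** (- dilation r q0) ** dilation r (dilation r^-1 (dilation r q0 ** ((- p) ** q))).
Proof.
by move=> r0; rewrite dilationK// -cartan_mulA mulVK mulKV.
Qed.

Let i12 (x : R) : 1 <= x <= 2 -> `|x| <= 20.
Proof. by rewrite ler_norml => ?; apply/andP; lra. Qed.

Let k20 : `|1 / 5 : R| <= 20.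
Proof. by rewrite ler_norml; apply/andP; lra. Qed.

Lemma near_both : \forall q \near q0, projects (1 / 5) q /\ projects (4 / 5) q.
Proof.
have i1 : 0 < (1 / 5 : R) < 1 by lra.
have i2 : 0 < (4 / 5 : R) < 1 by lra.
by apply: filterS2 (near_projects i1) (near_projects i2) => q.
Qed.

(** Every point near q0 is joined to one fixed point by three short horizontal segments:
the two segments given by [quartic_decomposition] for its foot, and the segment from
the foot back to the point.  A dilation makes the whole path short. *)
Lemma proportional (H : V -> R) :
  (forall q a b, projects (1 / 5) q -> projects (4 / 5) q ->
    `|a| <= 20 -> `|b| <= 20 ->
    H (q ** hv a b) * quartic q = H q * quartic (q ** hv a b)) ->
  exists k, \forall q \near q0, H q = k * quartic q.
Proof.
move=> prop; have C20 : (20 : R) <= 3000 by lra.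
have [r r01 HN] := dilated_box near_both C20.
have r0 : r != 0 by case/andP: r01 => /lt0r_neq0.
pose b := q0 ** (- dilation r q0).
pose n g := b ** dilation r g.
exists (H (n 0) / quartic (n 0)).
have chart := @chart_cvg q0 r r0.
have nb : \forall q \near q0, let g := dilation r^-1 (dilation r q0 ** ((- q0) ** q)) in
    projects (1 / 5) g /\ projects (4 / 5) g := chart _ near_both.
apply: filterS nb => q /= [pr _]; set g := dilation r^-1 _ in pr.
have -> : q = n g by exact: chartK.
have [_ _ _ [bg f20 c1 c2 [w1 w2]]] := pr.
have E := foot_decomposition pr.
set v1 := first_vertex _ false in c1 w1 E; set v2 := first_vertex _ true in c2 w2 E.
set d1 := _ - v1 in w1 E; set d2 := _ - v2 in w2 E.
have c1' := i12 c1; have c2' := i12 c2.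
have b0 : coords_le 20 (0 : V) by split; rewrite coord0 normr0 ler0n.
have b1 : coords_le 20 (hv v1 v2 : V) by split; rewrite /hv coordE ?normr0 ?ler0n.
have big (x : V) : coords_le 20 x -> coords_le 3000 x := coords_le_trans C20.
have b2 : coords_le 3000 (foot (1 / 5) g).
  by rewrite E -[hv d1 d2]scale1r; apply: coords_le_segment => //; rewrite ler01 lexx.
have step x c d : coords_le 3000 x -> coords_le 3000 (x ** hv c d) ->
    `|c| <= 20 -> `|d| <= 20 -> H (n x) / quartic (n x) =
    H (n (x ** hv c d)) / quartic (n (x ** hv c d)).
  move=> bx bx' c20 d20.
  have [p1 p2] := HN _ bx; have [[_ P' _ _] _] := HN _ bx'.
  have [_ P _ _] := p1.
  have T (y : R) : `|y| <= 20 -> `|r * y| <= 20.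
    case/andP: r01 => r0' r1' y20; rewrite normrM (ger0_norm (ltW r0')).
    by apply: le_trans y20; rewrite ler_piMl.
  have := prop _ (r * c) (r * d) p1 p2 (T _ c20) (T _ d20).
  rewrite -dilation_hv -cartan_mulA -dilationM -/b -/(n x) -/(n (x ** hv c d)) => e.
  rewrite -/b -/(n x) in P; rewrite -/b -/(n (x ** hv c d)) in P'.
  by apply: (mulIf P); apply: (mulIf P'); rewrite divfK// -e; field.
have s1 := step 0 v1 v2 (big _ b0).
have E0 : 0 ** hv v1 v2 = hv v1 v2 :> V.
  by apply: vec5_inj; rewrite /cartan_mul /hv !coordE; ring.
rewrite E0 in s1; rewrite s1//; last exact: big.
rewrite (step _ d1 d2)//; [|exact: big|by rewrite -E].
rewrite -E.
have E3 : foot (1 / 5) g ** hv (- foot1 (1 / 5) g) (- (1 / 5)) = g.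
  rewrite /foot (_ : hv (- _) (- (1 / 5)) = - hv (foot1 (1 / 5) g) (1 / 5)); last first.
    by apply: vec5_inj; rewrite /hv !coordE ?oppr0.
  by rewrite -cartan_mulA (_ : hv _ _ ** - hv _ _ = 0) ?mul0//;
    apply: vec5_inj; rewrite /cartan_mul /hv !coordE; ring.
rewrite (step _ (- foot1 (1 / 5) g) (- (1 / 5)))// ?E3 ?normrN//; last exact: big.
have [[_ P _ _] _] := HN _ (big _ bg).
by rewrite divfK.
Qed.

(** A dilation and a translation bring p to q0 and a neighbourhood of p to the bounded
part of the group where [ratio_line] and [proportional] apply. *)
Lemma affine_local (D : set V) (F : V -> R) (p : V) : open D -> D p ->
  horizontally_affine D F ->
  exists b s c0 c1 c2 A B C k, \forall q \near p,
    F q = affine6 c0 c1 c2 A B C (dilation s (b ** q))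
      + k * quartic (dilation s (b ** q)).
Proof.
move=> oD Dp [G1 [G2 aff]].
have C20 : (20 : R) <= 3000 by lra.
have [r r01 HD] := dilated_box (open_nbhs_nbhs (conj oD Dp)) C20.
have r0 : r != 0 by case/andP: r01 => /lt0r_neq0.
pose n g := p ** (- dilation r q0) ** dilation r g.
have affn : affine20 (fun g => F (n g)) (fun g => r * G1 (n g)) (fun g => r * G2 (n g)).
  move=> g a b bg a20 b20.
  rewrite {1}/n dilationM cartan_mulA -/(n g) dilation_hv aff; first by ring.
  move=> t t01.
  have -> : n g ** (t *: hv (r * a) (r * b)) = n (g ** (t *: hv a b)).
    rewrite /n dilationM cartan_mulA; congr (_ ** _).
    by apply: vec5_inj; rewrite /dilation /hv !coordE; ring.
  by apply: HD; exact: coords_le_segment.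
have [c0 [c1 [c2 [A [B [C prop]]]]]] := ratio_line affn.
have [k Hk] := proportional prop.
exists (dilation r q0 ** (- p)), r^-1, c0, c1, c2, A, B, C, k.
have nk : \forall q \near p, let g := dilation r^-1 (dilation r q0 ** ((- p) ** q)) in
    F (n g) - affine6 c0 c1 c2 A B C g = k * quartic g := @chart_cvg p r r0 _ Hk.
apply: filterS nk => q /=.
rewrite {1}/n -chartK// -cartan_mulA => <-.
by rewrite addrC subrK.
Qed.

End AffineLocal.

(** * Smoothness of rational functions *)

Section RationalSmoothness.
Context {R : realType}.
Local Notation V := 'rV[R]_5.

(** The zero linear map satisfies the definition of the differential. *)
Lemma differentiable_near0 (e : V -> R) p :
  (\forall x \near p, e x = 0) -> differentiable e p.
Proof.
move=> e0; apply/diffP.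
apply: (@getPex _ (fun df : {linear V -> R} => continuous df /\
  forall y, e y = e (lim (nbhs p)) + df (y - lim (nbhs p))
    +o_(y \near p) (y - lim (nbhs p)))).
exists (\0 : {linear V -> R}); split; first exact: (@cst_continuous V R 0).
have ep : e p = 0 := nbhs_singleton e0.
have : e = cst 0 +o_ p (fun y : V => y - lim (nbhs p)).
  apply/eqaddoP => _/posnumP[eps]; apply: filterS e0 => x ex.
  by rewrite -[_ x]/(e x - 0) ex subrr normr0 mulr_ge0.
rewrite funeqE => H y; rewrite lim_id// ep !add0r.
by rewrite [LHS]H lim_id// /cst add0r.
Qed.

Lemma near_eq_differentiable (u r : V -> R) p :
  (\forall x \near p, u x = r x) -> differentiable r p -> differentiable u p.
Proof.
move=> ur dr.
have -> : u = r + (u - r) by rewrite addrC subrK.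
apply: differentiableD => //; apply: differentiable_near0.
by apply: filterS ur => x ux; rewrite -[_ x]/(u x - r x) ux subrr.
Qed.

(** Inverses are admitted only where they make sense, which makes the class closed
under partial derivatives ([ratfun_derive]). *)
Inductive ratfun (U : set V) : (V -> R) -> Prop :=
| ratfun_cst c : ratfun U (fun=> c)
| ratfun_coord j : ratfun U (fun p => p 0 j)
| ratfunD u v : ratfun U u -> ratfun U v -> ratfun U (fun p => u p + v p)
| ratfunM u v : ratfun U u -> ratfun U v -> ratfun U (fun p => u p * v p)
| ratfunV u : ratfun U u -> (forall p, U p -> u p != 0) ->
    ratfun U (fun p => (u p)^-1).

Lemma ratfun_differentiable U u p : ratfun U u -> U p -> differentiable u p.
Proof.
move=> ru Up; elim: ru => {u} [c|j|u v _ du _ dv|u v _ du _ dv|u _ du u0].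
- exact: differentiable_cst.
- exact: differentiable_coord.
- exact: differentiableD.
- exact: differentiableM.
- by apply: differentiableV => //; exact: u0.
Qed.

Lemma ratfun_derive U u i : ratfun U u -> exists2 u', ratfun U u' &
  forall p, U p -> 'D_(delta_mx 0 i) u p = u' p.
Proof.
have dd w p : ratfun U w -> U p -> derivable w p (delta_mx 0 i).
  by move=> rw Up; apply/diff_derivable/(ratfun_differentiable rw).
elim=> {u} [c|j|u v ru [u' ru' uE] rv [v' rv' vE]|
    u v ru [u' ru' uE] rv [v' rv' vE]|u ru [u' ru' uE] u0].
- exists (fun=> 0); first exact: ratfun_cst.
  by move=> p _; rewrite derive_cst.
- exists (fun=> (i == j)%:R); first exact: ratfun_cst.
  move=> p _.
  have did : derivable (id : V -> V) p (delta_mx 0 i) by exact: derivable_id.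
  have := @derive_mx R V 1 5 id p (delta_mx 0 i) did.
  rewrite derive_id => /(congr1 (fun M : V => M 0 j)).
  by rewrite !mxE eqxx eq_sym /= => <-.
- exists (fun p => u' p + v' p); first exact: ratfunD.
  by move=> p Up; rewrite -uE// -vE// deriveD//; exact: dd.
- exists (fun p => u p * v' p + v p * u' p).
    by apply: ratfunD; exact: ratfunM.
  by move=> p Up; rewrite -uE// -vE// deriveM//; exact: dd.
- exists (fun p => - 1 * ((u p)^-1 * (u p)^-1) * u' p).
    apply: ratfunM => //; apply: ratfunM; first exact: ratfun_cst.
    by apply: ratfunM; exact: ratfunV.
  move=> p Up; rewrite -uE// deriveV ?u0//; last exact: dd.
  by rewrite /GRing.scale /= mulN1r -invfM -expr2.
Qed.

Definition locally_rational (U : set V) (u : V -> R) : Prop :=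
  forall p, U p -> exists W r,
    [/\ open W, W p, ratfun W r & forall q, W q -> u q = r q].

Lemma locally_rational_differentiable U u p :
  locally_rational U u -> U p -> differentiable u p.
Proof.
move=> H /H[W [r [oW Wp rr ur]]].
apply: (@near_eq_differentiable _ r); last exact: ratfun_differentiable rr Wp.
by apply: filterS (open_nbhs_nbhs (conj oW Wp)); exact: ur.
Qed.

Lemma locally_rational_derive U u i : locally_rational U u ->
  locally_rational U (fun p => 'D_(delta_mx 0 i) u p).
Proof.
move=> H p /H[W [r [oW Wp rr ur]]].
have [r' rr' rE] := ratfun_derive i rr.
exists W, r'; split=> // q Wq; rewrite -rE//.
apply: near_eq_derive.
by apply: filterS (open_nbhs_nbhs (conj oW Wq)); exact: ur.
Qed.

Lemma differentiable_rV (g : V -> V) p :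
  (forall j, differentiable (fun q => g q 0 j) p) -> differentiable g p.
Proof.
move=> dg.
have -> : g = (fun q => \sum_(j < 5) (g q 0 j *: delta_mx 0 j)).
  by apply/funext => q; rewrite -row_sum_delta.
have -> : (fun q => \sum_(j < 5) (g q 0 j *: delta_mx 0 j)) =
    \sum_(j < 5) (fun q => g q 0 j *: (delta_mx 0 j : V)).
  by apply/funext => q; rewrite fct_sumE.
by apply: differentiable_sum => j; exact: differentiableZl.
Qed.

Lemma ratfun_sub (U W : set V) u : W `<=` U -> ratfun U u -> ratfun W u.
Proof.
move=> WU; elim=> {u} [c|j|u v _ ru _ rv|u v _ ru _ rv|u _ ru u0].
- exact: ratfun_cst.
- exact: ratfun_coord.
- exact: ratfunD.
- exact: ratfunM.
- by apply: ratfunV => // p /WU; exact: u0.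
Qed.

Lemma locally_rational_eq U u v : open U -> (forall p, U p -> u p = v p) ->
  locally_rational U u -> locally_rational U v.
Proof.
move=> oU uv H p Up; have [W [r [oW Wp rr ur]]] := H p Up.
exists (W `&` U), r; split => //.
- exact: openI.
- exact: ratfun_sub rr.
- by move=> q [Wq Uq]; rewrite -uv// ur.
Qed.

(** Induction on k, since the partial derivatives are locally rational again. *)
Lemma locally_rational_Ck k (U : set V) (g : V -> V) : open U ->
  (forall j, locally_rational U (fun p => g p 0 j)) -> Ck k U g.
Proof.
move=> oU; have dg (h : V -> V) p : (forall j, locally_rational U (fun p => h p 0 j)) ->
    U p -> differentiable h p.
  move=> H Up; apply: differentiable_rV => j.
  exact: locally_rational_differentiable (H j) Up.
elim: k g => [|k IHk] g H /=.
  by move=> p Up; apply: differentiable_continuous; exact: dg.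
split=> [p|i]; first exact: dg.
apply: IHk => j; apply: locally_rational_eq (locally_rational_derive i (H j)) => //.
by move=> p Up; rewrite derive_mx ?mxE//; apply/diff_derivable/dg.
Qed.

End RationalSmoothness.

(** * Contact maps in left-invariant frames *)

Section Bridge.
Context {R : realType}.
Local Notation V := 'rV[R]_5.

(** Coordinates of a tangent vector at p in the left-invariant frame. *)
Definition unlft (p v : V) : V :=
  let y := cy v - 2^-1 * wedge p v in
  vec5 (cx1 v) (cx2 v) y
    (cz1 v - 2^-1 * (cx1 p * y - cy p * cx1 v) - 12^-1 * cx1 p * wedge p v)
    (cz2 v - 2^-1 * (cx2 p * y - cy p * cx2 v) - 12^-1 * cx2 p * wedge p v).

Lemma unlftK p v : lft (unlft p v) p = v.
Proof. by apply: vec5_inj; rewrite /unlft /lft /wedge !coordE; field. Qed.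

Lemma lftK p v : unlft p (lft v p) = v.
Proof. by apply: vec5_inj; rewrite /unlft /lft /wedge !coordE; field. Qed.

Lemma unlft_linear p a u v : unlft p (a *: u + v) = a *: unlft p u + unlft p v.
Proof. by apply: vec5_inj; rewrite /unlft /wedge !coordE; ring. Qed.

Lemma cvg_unlft (T : Type) (F : set_system T) {FF : Filter F} (g h : T -> V) p q :
  g @ F --> p -> h @ F --> q -> (fun x => unlft (g x) (h x)) @ F --> unlft p q.
Proof.
move=> /cvg_coord[? ? ? ? ?] /cvg_coord[? ? ? ? ?].
apply: cvg_vec5; rewrite /unlft /wedge /= ?coordE;
  under eq_fun do rewrite ?coordE; cvg_poly.
Qed.

Lemma cvg_sum_ord (T : Type) (F : set_system T) {FF : Filter F} n
    (g : 'I_n -> T -> V) (l : 'I_n -> V) :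
  (forall i, g i @ F --> l i) ->
  (fun x => \sum_(i < n) g i x) @ F --> \sum_(i < n) l i.
Proof.
elim: n g l => [|n IHn] g l gl.
  have -> : (fun x => \sum_(i < 0) g i x) = fun=> 0.
    by apply/funext => x; rewrite big_ord0.
  by rewrite big_ord0; exact: cvg_cst.
have -> : (fun x => \sum_(i < n.+1) g i x) =
    fun x => \sum_(i < n) g (widen_ord (leqnSn n) i) x + g ord_max x.
  by apply/funext => x; rewrite big_ord_recr.
rewrite big_ord_recr /=; apply: cvgD; last exact: gl.
by apply: IHn => i; exact: gl.
Qed.

Lemma ray_derive (q W : V) :
  derivable (fun s : R => q ** (s *: W)) 0 1 /\
  'D_1 (fun s : R => q ** (s *: W)) 0 = lft W q.
Proof.
have D j : is_derive (0 : R) (1 : R) (fun s : R => (q ** (s *: W)) 0 j) (lft W q 0 j).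
  move: j; apply: ord5P; rewrite -?/(cx1 _) -?/(cx2 _) -?/(cy _) -?/(cz1 _) -?/(cz2 _).
  - under eq_fun do rewrite -/(cx1 _) /cartan_mul !coordE.
    rewrite -/(cx1 (lft W q)) /lft !coordE.
    by apply: is_derive_eq; rewrite /GRing.scale /=; ring.
  - under eq_fun do rewrite -/(cx2 _) /cartan_mul !coordE.
    rewrite -/(cx2 (lft W q)) /lft !coordE.
    by apply: is_derive_eq; rewrite /GRing.scale /=; ring.
  - under eq_fun do rewrite -/(cy _) /cartan_mul !coordE.
    rewrite -/(cy (lft W q)) /lft /wedge !coordE.
    by apply: is_derive_eq; rewrite /GRing.scale /=; field.
  - under eq_fun do rewrite -/(cz1 _) /cartan_mul !coordE.
    rewrite -/(cz1 (lft W q)) /lft /wedge !coordE.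
    by apply: is_derive_eq; rewrite /GRing.scale /=; field.
  - under eq_fun do rewrite -/(cz2 _) /cartan_mul !coordE.
    rewrite -/(cz2 (lft W q)) /lft /wedge !coordE.
    by apply: is_derive_eq; rewrite /GRing.scale /=; field.
have d : derivable (fun s : R => q ** (s *: W)) 0 1.
  by apply/derivable_mxP => i j; rewrite ord1; case: (D j).
split=> //; rewrite derive_mx//; apply/matrixP => i j; rewrite mxE ord1.
by case: (D j).
Qed.

Context (Om : set V) (openOm : open Om) (f : V -> V).
Context (C1f : Ck 1 Om f).

Definition left_diff (W q : V) : V := unlft (f q) ('d f q (lft W q)).

Let df q : Om q -> differentiable f q.
Proof. by case: C1f => H _; exact: H. Qed.

Let diff_sum q (v : V) : Om q ->
  'd f q v = \sum_(i < 5) v 0 i *: 'D_(delta_mx 0 i) f q.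
Proof.
move=> Oq; rewrite {1}[v]row_sum_delta linear_sum.
by apply: eq_bigr => i _; rewrite linearZ /= deriveE//; exact: df.
Qed.

(** The differential is a combination of the partial derivatives, which are continuous
by assumption, with polynomial coefficients. *)
Lemma left_diff_cvg W q : Om q -> left_diff W @ q --> left_diff W q.
Proof.
move=> Oq; have [_ Cf] := C1f.
apply: (@cvg_unlft V (nbhs q) (nbhs_filter q) f (fun x => 'd f x (lft W x))).
  exact: (differentiable_continuous (df Oq)).
have E : \forall x \near q,
    \sum_(i < 5) lft W x 0 i *: 'D_(delta_mx 0 i) f x = 'd f x (lft W x).
  apply: filterS (open_nbhs_nbhs (conj openOm Oq)) => x Ox.
  by rewrite (diff_sum _ Ox).
have c : (fun x => lft W x) @ q --> lft W q.
  by apply: (@cvg_lft R V (nbhs q) (nbhs_filter q) (fun=> W) id);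
    [exact: cvg_cst|exact: cvg_id].
have L l : l = \sum_(i < 5) lft W q 0 i *: 'D_(delta_mx 0 i) f q ->
    (fun x => \sum_(i < 5) lft W x 0 i *: 'D_(delta_mx 0 i) f x) @ nbhs q --> l.
  move=> ->; apply: (@cvg_sum_ord V (nbhs q) (nbhs_filter q) 5
    (fun i x => lft W x 0 i *: 'D_(delta_mx 0 i) f x)) => i.
  have ci := cvg_comp _ _ c (@coord_continuous R 1 5 0 i (lft W q)).
  exact: cvgZ ci (Cf i q Oq).
exact: (cvg_trans (near_eq_cvg E) (L _ (diff_sum (lft W q) Oq))).
Qed.

Lemma C1_left_differential : left_differential Om f left_diff.
Proof.
split.
- move=> q W j Oq; rewrite /left_diff unlftK.
  have [dc Dc] := ray_derive q W.
  set c := (fun s : R => q ** (s *: W)) in dc Dc *.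
  have c0 : c 0 = q by rewrite /c scale0r mul0.
  have dfc : differentiable f (c 0) by rewrite c0; exact: df.
  have dc' : differentiable c 0 by apply/derivable1_diffP.
  have dcomp : differentiable (f \o c) 0 by exact: differentiable_comp.
  have d : derivable (f \o c) 0 1 by exact: diff_derivable.
  have D : 'D_1 (f \o c) 0 = 'd f q (lft W q).
    have e1 : 'D_1 (f \o c) 0 = 'd (f \o c) 0 1 := deriveE _ dcomp.
    have e2 : 'd (f \o c) 0 1 = 'd f (c 0) ('d c 0 1).
      exact: (congr1 (fun h : R -> V => h 1) (diff_comp dc' dfc)).
    have e3 : 'D_1 c 0 = 'd c 0 1 := deriveE _ dc'.
    by rewrite e1 e2 -e3 Dc c0.
  apply: DeriveDef; first by move/derivable_mxP: d; exact.
  by rewrite -D derive_mx// mxE.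
- move=> a U W q Oq; rewrite /left_diff lftD lftZ linearP.
  exact: unlft_linear.
- by move=> q W; exact: left_diff_cvg.
- by move=> q Oq; exact: (differentiable_continuous (df Oq)).
Qed.

Context (contact : forall p, Om p -> 'd f p @` [set` horizontal p] = [set` horizontal (f p)]).

Lemma horizontalP (p v : V) : v \in horizontal p <-> exists a b, v = lft (hv a b) p.
Proof.
rewrite /horizontal span_cons span_seq1; split.
  move=> /memv_addP[u /vlineP[a ->] [w /vlineP[b ->] ->]].
  by exists a, b; rewrite lft_hv.
move=> [a [b ->]]; rewrite lft_hv; apply: memv_add; apply/vlineP.
  by exists a.
by exists b.
Qed.

(** The differential maps the horizontal plane onto a horizontal plane, so its
restriction is an isomorphism. *)
Lemma C1_contact_differential : contact_differential Om f left_diff.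
Proof.
have ld := C1_left_differential.
have hor q a b : Om q -> exists c d, left_diff (hv a b) q = hv c d.
  move=> Oq; have : ('d f q @` [set` horizontal q]) ('d f q (lft (hv a b) q)).
    exists (lft (hv a b) q) => //=; apply/horizontalP; by exists a, b.
  rewrite contact// /= => /horizontalP[c [d E]].
  by exists c, d; rewrite /left_diff E lftK.
split=> //.
- move=> q a b Oq; have [c [d ->]] := hor q a b Oq.
  by rewrite /hv !coordE.
- move=> q Oq.
  have sur c d : exists a b, left_diff (hv a b) q = hv c d.
    have : [set` horizontal (f q)] (lft (hv c d) (f q)).
      by rewrite /=; apply/horizontalP; exists c, d.
    rewrite -contact// => -[u /= /horizontalP[a [b ->]] E].
    by exists a, b; rewrite /left_diff E lftK.
  have [a [b E1]] := sur 1 0; have [c [d E2]] := sur 0 1.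
  have lin a' b' : left_diff (hv a' b') q =
      a' *: left_diff (hv 1 0) q + b' *: left_diff (hv 0 1) q.
    rewrite -!(ldZ ld)// -(ldD ld)//; congr (left_diff _ _).
    by apply: vec5_inj; rewrite /hv !coordE; ring.
  apply/eqP => w0.
  have : wedge (left_diff (hv a b) q) (left_diff (hv c d) q) = 1.
    by rewrite E1 E2 /wedge /hv !coordE; ring.
  rewrite (lin a b) (lin c d) => H.
  suff : (0 : R) = 1 by move/eqP; rewrite eq_sym oner_eq0.
  transitivity ((a * d - b * c) *
      wedge (left_diff (hv 1 0) q) (left_diff (hv 0 1) q)).
    by rewrite w0 mulr0.
  by rewrite -[RHS]H /wedge !coordE; ring.
Qed.

End Bridge.

(** * Smoothness of contact maps *)

Section LocallyRationalAlgebra.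
Context {R : realType}.
Local Notation V := 'rV[R]_5.
Implicit Types (U : set V) (u v : V -> R).

Lemma ratfunN U u : ratfun U u -> ratfun U (fun p => - u p).
Proof.
move=> ru; have -> : (fun p => - u p) = (fun p => - 1 * u p).
  by apply/funext => p; rewrite mulN1r.
by apply: ratfunM => //; exact: ratfun_cst.
Qed.

Lemma ratfunX U u n : ratfun U u -> ratfun U (fun p => u p ^+ n).
Proof.
move=> ru; elim: n => [|n IHn]; first exact: ratfun_cst.
have -> : (fun p => u p ^+ n.+1) = (fun p => u p * u p ^+ n).
  by apply/funext => p; rewrite exprS.
exact: ratfunM.
Qed.

Ltac ratfun_tac := repeat
  lazymatch goal with
  | |- ratfun _ (fun _ => ?c) => exact: ratfun_cst
  | |- ratfun _ (fun x => _ + _) => apply: ratfunD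
  | |- ratfun _ (fun x => - _) => apply: ratfunN
  | |- ratfun _ (fun x => _ * _) => apply: ratfunM
  | |- ratfun _ (fun x => _ ^+ _) => apply: ratfunX
  | |- _ => assumption
  end.

Lemma ratfun_chart U b s c0 c1 c2 A B C k : ratfun U (fun q =>
  affine6 c0 c1 c2 A B C (dilation s (b ** q)) + k * quartic (dilation s (b ** q))).
Proof.
have x1 : ratfun U (fun q => cx1 q) by exact: ratfun_coord.
have x2 : ratfun U (fun q => cx2 q) by exact: ratfun_coord.
have x3 : ratfun U (fun q => cy q) by exact: ratfun_coord.
have x4 : ratfun U (fun q => cz1 q) by exact: ratfun_coord.
have x5 : ratfun U (fun q => cz2 q) by exact: ratfun_coord.
set chart := fun q => dilation s (b ** q).
have [y1 y2 y3 y4 y5] : [/\ ratfun U (fun q => cx1 (chart q)),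
    ratfun U (fun q => cx2 (chart q)), ratfun U (fun q => cy (chart q)),
    ratfun U (fun q => cz1 (chart q)) & ratfun U (fun q => cz2 (chart q))].
  by rewrite /chart /dilation /cartan_mul; split; under eq_fun do rewrite !coordE;
    ratfun_tac.
rewrite -[X in ratfun _ X]/(fun q => affine6 c0 c1 c2 A B C (chart q) + k * quartic (chart q)).
by rewrite /affine6 /lin3 /quartic /sh /sx /sz; ratfun_tac.
Qed.

Lemma affine_locally_rational U u : open U -> horizontally_affine U u ->
  locally_rational U u.
Proof.
move=> oU aff p Up.
have [b [s [c0 [c1 [c2 [A [B [C [k H]]]]]]]]] := affine_local oU Up aff.
have /nbhs_interior := H; set W := interior _ => Wp.
exists W, (fun q => affine6 c0 c1 c2 A B C (dilation s (b ** q))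
  + k * quartic (dilation s (b ** q))).
split.
- exact: open_interior.
- exact: nbhs_singleton Wp.
- exact: ratfun_chart.
- by move=> q /interior_subset.
Qed.

Lemma locally_rational2 (op : R -> R -> R) U u v :
  (forall W r s, ratfun W r -> ratfun W s -> ratfun W (fun p => op (r p) (s p))) ->
  locally_rational U u -> locally_rational U v ->
  locally_rational U (fun p => op (u p) (v p)).
Proof.
move=> opr ru rv p Up; have [W [r [oW Wp rr ur]]] := ru p Up.
have [W' [r' [oW' Wp' rr' ur']]] := rv p Up.
exists (W `&` W'), (fun p => op (r p) (r' p)); split.
- exact: openI.
- by [].
- by apply: opr; [apply: ratfun_sub rr|apply: ratfun_sub rr'] => q [].
- by move=> q [Wq W'q]; rewrite ur// ur'.
Qed.

Lemma locally_rationalV U u : open U -> (forall p, U p -> u p != 0) ->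
  locally_rational U u -> locally_rational U (fun p => (u p)^-1).
Proof.
move=> oU u0 ru p Up; have [W [r [oW Wp rr ur]]] := ru p Up.
exists (W `&` U), (fun p => (r p)^-1); split.
- exact: openI.
- by [].
- apply: ratfunV; first by apply: ratfun_sub rr => q [].
  by move=> q [Wq Uq]; rewrite -ur//; exact: u0.
- by move=> q [Wq _]; rewrite ur.
Qed.

End LocallyRationalAlgebra.

Theorem theorem1p1 (R : realType) (Omega : set 'rV[R]_5)
    (f : 'rV[R]_5 -> 'rV[R]_5) (openO : open Omega)
    (contactf : contact_mapping 1 Omega f) :
  Cinfty Omega f.
Proof.
case: contactf => [[g [_ _ _ C1f _]] contact] k.
have cd := C1_contact_differential openO C1f contact.
set m := left_diff f in cd.
have J0 p : Omega p -> J m p != 0 := @J_neq0 _ _ openO _ _ cd p.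
have rJ := affine_locally_rational openO (affine_Jinv openO cd).
have [ax ay ah] := affine_image openO cd.
have rx i := affine_locally_rational openO (ax i).
have ry := affine_locally_rational openO ay.
have rh i := affine_locally_rational openO (ah i).
(* The components of f are recovered by dividing by 1/J. *)
have rJV : locally_rational Omega (fun p => ((J m p)^-1)^-1).
  by apply: locally_rationalV => // p Op; rewrite invr_neq0 ?J0.
have mul (u v : 'rV[R]_5 -> R) : locally_rational Omega u ->
    locally_rational Omega v -> locally_rational Omega (fun p => u p * v p).
  by apply: (locally_rational2 (op := fun x y => x * y)) => W r s; exact: ratfunM.
have add (u v : 'rV[R]_5 -> R) : locally_rational Omega u ->
    locally_rational Omega v -> locally_rational Omega (fun p => u p + v p).
  by apply: (locally_rational2 (op := fun x y => x + y)) => W r s; exact: ratfunD.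
have cst c : locally_rational Omega (fun=> c).
  move=> p Op; exists setT, (fun=> c); split=> //; first exact: openT.
  exact: ratfun_cst.
have X i : locally_rational Omega (fun p => sx i (f p)).
  apply: (locally_rational_eq openO) (mul _ _ (rx i) rJV) => p Op.
  by rewrite invrK divfK// J0.
have Y : locally_rational Omega (fun p => cy (f p)).
  apply: (locally_rational_eq openO) (mul _ _ ry rJV) => p Op.
  by rewrite invrK divfK// J0.
have H i : locally_rational Omega (fun p => sh i (f p)).
  apply: (locally_rational_eq openO) (mul _ _ (rh i) rJV) => p Op.
  by rewrite invrK divfK// J0.
have Z i : locally_rational Omega (fun p => sz i (f p)).
  have := mul _ _ (cst 6^-1) (add _ _ (H i) (mul _ _ (cst (- 1)) (mul _ _ (X i) Y))).
  apply: (locally_rational_eq openO) => p Op.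
  by rewrite /sh; field.
apply: locally_rational_Ck => //; apply: ord5P.
- exact: (X false).
- exact: (X true).
- exact: Y.
- exact: (Z false).
- exact: (Z true).
Qed.
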